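(* Let $K \in \mathcal{K}^n$. Then $$\min_{A \in GL_n(\mathbb{R})}\frac{D(AK)}{2r(AK)} \le \sqrt{\frac{n(n+1)}{2}},$$ with equality if and only if $K$ is a simplex.
   Context: $\mathcal{K}^n$ is the family of convex bodies in $\mathbb{R}^n$, i.e., compact convex sets with non-empty interior. $D(K)$ is the Euclidean diameter of $K$ and $r(K)$ is the Euclidean inradius of $K$ (largest radius of a Euclidean ball contained in $K$). A simplex here is the convex hull of $n+1$ affinely independent points in $\mathbb{R}^n$ (not necessarily regular). *)

(* Defs.v *)
From HB Require Import structures.
From mathcomp Require Import all_boot all_order all_algebra.
From mathcomp Require Import all_classical all_reals all_analysis.

Set Implicit Arguments.
Unset Strict Implicit.
Unset Printing Implicit Defensive.

Import Order.TTheory GRing.Theory Num.Theory.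
Import numFieldNormedType.Exports.

Local Open Scope classical_set_scope.
Local Open Scope ring_scope.

(* The library norm on matrices is the sup norm, so the Euclidean norm is
   defined separately; both induce the same topology, hence the library's
   [compact] and [interior] can be used unchanged. *)
Definition enorm (R : realType) (n : nat) (x : 'cV[R]_n) : R :=
  Num.sqrt (\sum_(i < n) x i ord0 ^+ 2).

Definition eball (R : realType) (n : nat) (c : 'cV[R]_n) (rho : R)
    : set 'cV[R]_n :=
  [set x | enorm (x - c) <= rho].

Definition convex_body (R : realType) (n : nat) (K : set 'cV[R]_n) : Prop :=
  [/\ compact K, convex_set K & interior K !=set0].

Definition diameter (R : realType) (n : nat) (K : set 'cV[R]_n) : R :=
  sup [set d | exists x y, [/\ K x, K y & d = enorm (x - y)]].

Definition inradius (R : realType) (n : nat) (K : set 'cV[R]_n) : R :=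
  sup [set rho | 0 <= rho /\ exists c, eball c rho `<=` K].

Definition linear_image (R : realType) (n : nat) (A : 'M[R]_n)
    (K : set 'cV[R]_n) : set 'cV[R]_n :=
  (fun x => A *m x) @` K.

Definition affinely_independent (R : realType) (n k : nat)
    (p : 'I_k -> 'cV[R]_n) : Prop :=
  forall l : 'I_k -> R,
    \sum_(i < k) l i = 0 -> \sum_(i < k) l i *: p i = 0 -> forall i, l i = 0.

Definition finite_convex_hull (R : realType) (n k : nat)
    (p : 'I_k -> 'cV[R]_n) : set 'cV[R]_n :=
  [set x | exists l : 'I_k -> R,
    [/\ forall i, 0 <= l i, \sum_(i < k) l i = 1
      & x = \sum_(i < k) l i *: p i]].

Definition is_simplex (R : realType) (n : nat) (K : set 'cV[R]_n) : Prop :=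
  exists p : 'I_n.+1 -> 'cV[R]_n,
    affinely_independent p /\ K = finite_convex_hull p.

Definition is_minimum (R : realType) (S : set R) (m : R) : Prop :=
  S m /\ lbound S m.

Definition diameter_inradius_ratios (R : realType) (n : nat)
    (K : set 'cV[R]_n) : set R :=
  [set diameter (linear_image A K) / (2 * inradius (linear_image A K))
     | A in [set A : 'M[R]_n | A \in unitmx]].

(* Main.v *)
Require Import Defs.
From HB Require Import structures.
From mathcomp Require Import all_boot all_order all_algebra.
From mathcomp Require Import all_classical all_reals all_analysis.
From mathcomp Require Import ring lra.

Set Implicit Arguments.
Unset Strict Implicit.
Unset Printing Implicit Defensive.

Import Order.TTheory GRing.Theory Num.Theory.
Import numFieldNormedType.Exports.

Local Open Scope classical_set_scope.
Local Open Scope ring_scope.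

(** Upper bound. Put [K] in John position: after an affine map the unit ball is
    an ellipsoid of maximal volume in [K]. Then [<x, y> >= - n] for all [x], [y]
    in [K] ([john_dot]); taking for [y] the unit vector opposite to [x] gives
    [|x| <= n]. Hence [|x - y|^2 <= 2 n (n + 1)], whereas the inradius is at
    least 1, so the ratio is at most [sqrt (n (n + 1) / 2)]. John's theorem
    enters only through the first-order condition [john_contact]: a deformation
    of the ball that increases its volume to first order cannot point strictly
    inwards at every contact normal.

    Equality forces a simplex. In John position two distinct points of norm [n]
    have inner product [- n] ([john_extreme]), so these points are vertices of a
    regular simplex circumscribed about the ball. If there are [n + 1] of them,
    [K] is that simplex ([full_frame_simplex]). If there are fewer, the pairs of
    points realising the bound on the diameter have differences in a proper
    subspace that contains no contact normal; contracting this subspace a little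
    lowers the diameter faster than the inradius ([john_not_simplex]), and the
    minimum is strictly below the bound.

    A simplex attains the bound. For every simplex, and hence for all its linear
    images, the diameter is at least [sqrt (2 n (n + 1))] times the inradius
    ([simplex_diameter]), as one sees from the gradients of the barycentric
    coordinates.

    The minimum exists because the ratio is invariant under dilations and its
    inverse extends continuously by 0 to the singular nonzero matrices
    ([ratio_min]). *)

(** * Euclidean geometry of column vectors *)

Section Euclid.
Variables (R : realType) (n : nat).
Implicit Types (x y z u v w : 'cV[R]_n) (a b : R) (A B S : 'M[R]_n).

Definition dot x y : R := \sum_(i < n) x i ord0 * y i ord0.

Lemma dotC x y : dot x y = dot y x.
Proof. by apply: eq_bigr => i _; rewrite mulrC. Qed.

Lemma dotDl x y z : dot (x + y) z = dot x z + dot y z.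
Proof. by rewrite -big_split; apply: eq_bigr => i _; rewrite mxE mulrDl. Qed.

Lemma dotZl a x y : dot (a *: x) y = a * dot x y.
Proof. by rewrite /dot mulr_sumr; apply: eq_bigr => i _; rewrite mxE mulrA. Qed.

Lemma dotDr x y z : dot z (x + y) = dot z x + dot z y.
Proof. by rewrite dotC dotDl !(dotC z). Qed.

Lemma dotZr a x y : dot y (a *: x) = a * dot y x.
Proof. by rewrite dotC dotZl dotC. Qed.

Lemma dotNl x y : dot (- x) y = - dot x y.
Proof. by rewrite -scaleN1r dotZl mulN1r. Qed.

Lemma dotNr x y : dot y (- x) = - dot y x.
Proof. by rewrite dotC dotNl dotC. Qed.

Lemma dot0l y : dot 0 y = 0.
Proof. by rewrite -(scale0r 0) dotZl mul0r. Qed.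

Lemma dot0r y : dot y 0 = 0.
Proof. by rewrite dotC dot0l. Qed.

Definition dotE := (dotDl, dotDr, dotNl, dotNr, dotZl, dotZr).

Lemma dot_suml I (r : seq I) (F : I -> 'cV[R]_n) y :
  dot (\sum_(i <- r) F i) y = \sum_(i <- r) dot (F i) y.
Proof.
elim: r => [|i r IH]; first by rewrite !big_nil dot0l.
by rewrite !big_cons dotDl IH.
Qed.

Lemma dot_sumr I (r : seq I) (F : I -> 'cV[R]_n) y :
  dot y (\sum_(i <- r) F i) = \sum_(i <- r) dot y (F i).
Proof. by rewrite dotC dot_suml; apply: eq_bigr => i _; rewrite dotC. Qed.

Lemma dot_mx x y : dot x y = (x^T *m y) ord0 ord0.
Proof. by rewrite mxE; apply: eq_bigr => i _; rewrite mxE. Qed.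

Lemma dot_mulmx A x y : dot (A *m x) y = dot x (A^T *m y).
Proof. by rewrite !dot_mx trmx_mul mulmxA. Qed.

Lemma dot_ge0 x : 0 <= dot x x.
Proof. by apply: sumr_ge0 => i _; rewrite -expr2 sqr_ge0. Qed.

Lemma dot_eq0 x : dot x x = 0 -> x = 0.
Proof.
move=> x0; apply/matrixP => i j; rewrite !mxE ord1.
have /psumr_eq0P/(_ i isT)/eqP : \sum_(i < n) x i ord0 * x i ord0 = 0 by [].
rewrite mulf_eq0 orbb => h; apply/eqP/h => k _.
by rewrite -expr2 sqr_ge0.
Qed.

Lemma dot_gt0 x : x != 0 -> 0 < dot x x.
Proof.
move=> x0; rewrite lt_neqAle dot_ge0 andbT eq_sym.
by apply: contra x0 => /eqP/dot_eq0/eqP.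
Qed.

Lemma sqr_enorm x : enorm x ^+ 2 = dot x x.
Proof.
by rewrite sqr_sqrtr ?sumr_ge0// => i _; rewrite sqr_ge0.
Qed.

Lemma enorm_ge0 x : 0 <= enorm x. Proof. exact: sqrtr_ge0. Qed.

Lemma enormE x : enorm x = Num.sqrt (dot x x).
Proof. by rewrite -sqr_enorm sqrtr_sqr ger0_norm ?enorm_ge0. Qed.

Lemma enorm_le x b : 0 <= b -> (enorm x <= b) = (dot x x <= b ^+ 2).
Proof. by move=> b0; rewrite -sqr_enorm ler_sqr ?nnegrE ?enorm_ge0. Qed.

Lemma enorm_eq0 x : enorm x = 0 -> x = 0.
Proof. by move=> x0; apply: dot_eq0; rewrite -sqr_enorm x0 expr0n. Qed.

Lemma enorm_gt0 x : x != 0 -> 0 < enorm x.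
Proof. by move=> x0; rewrite enormE sqrtr_gt0 dot_gt0. Qed.

Lemma enorm0 : enorm (0 : 'cV[R]_n) = 0.
Proof. by rewrite enormE dot0l sqrtr0. Qed.

Lemma enormZ a x : enorm (a *: x) = `|a| * enorm x.
Proof.
by rewrite !enormE !dotE mulrA -expr2 sqrtrM ?sqr_ge0// sqrtr_sqr.
Qed.

Lemma enormN x : enorm (- x) = enorm x.
Proof. by rewrite -scaleN1r enormZ normrN1 mul1r. Qed.

Lemma enorm_normalized x : x != 0 -> enorm ((enorm x)^-1 *: x) = 1.
Proof.
move=> x0; rewrite enormZ ger0_norm ?invr_ge0 ?enorm_ge0//.
by rewrite mulVf// gt_eqF// enorm_gt0.
Qed.

Lemma dot_normalized x : x != 0 -> dot ((enorm x)^-1 *: x) x = enorm x.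
Proof.
by move=> x0; rewrite dotZl -sqr_enorm expr2 mulKf// gt_eqF// enorm_gt0.
Qed.

Lemma enorm_delta j : enorm (delta_mx j ord0 : 'cV[R]_n) = 1.
Proof.
rewrite enormE /dot (bigD1 j)//= !mxE eqxx mulr1 big1 ?addr0 ?sqrtr1//.
by move=> k /negbTE kj; rewrite !mxE kj mul0r.
Qed.

Lemma cauchy_schwarz_sqr x y : dot x y ^+ 2 <= dot x x * dot y y.
Proof.
have [->|/dot_gt0 y0] := eqVneq y 0; first by rewrite !dot0r expr0n mulr0.
have := dot_ge0 (dot y y *: x - dot x y *: y).
rewrite !dotE (dotC y x) => h.
have : 0 <= dot y y * (dot x x * dot y y - dot x y ^+ 2) by nra.
by rewrite pmulr_rge0// subr_ge0.
Qed.

Lemma cauchy_schwarz x y : dot x y <= enorm x * enorm y.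
Proof.
apply: le_trans (ler_norm _) _.
rewrite -ler_sqr ?nnegrE ?mulr_ge0 ?enorm_ge0//.
by rewrite exprMn !sqr_enorm real_normK ?num_real// cauchy_schwarz_sqr.
Qed.

Lemma enormD x y : enorm (x + y) <= enorm x + enorm y.
Proof.
rewrite enorm_le ?addr_ge0 ?enorm_ge0// !dotE (dotC y x) -!sqr_enorm.
have := cauchy_schwarz x y; lra.
Qed.

Lemma enorm_coord x i : `|x i ord0| <= enorm x.
Proof.
rewrite -ler_sqr ?nnegrE ?enorm_ge0// sqr_enorm real_normK ?num_real//.
rewrite /dot (bigD1 i)//= -expr2 lerDl sumr_ge0// => j _.
by rewrite -expr2 sqr_ge0.
Qed.

Lemma norm_le_enorm x : `|x| <= enorm x.
Proof.
rewrite [leLHS]/Num.norm /= mx_normrE; apply/bigmax_leP; split=> [|[i j] _].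
  exact: enorm_ge0.
by rewrite /= ord1 enorm_coord.
Qed.

Lemma coord_le_norm m p (A : 'M[R]_(m, p)) i j : `|A i j| <= `|A|.
Proof.
rewrite [leRHS]/Num.norm /= mx_normrE.
exact: (@le_bigmax _ _ _ 0 (fun ij : 'I_m * 'I_p => `|A ij.1 ij.2|) (i, j)).
Qed.

Lemma enorm_le_norm x : enorm x <= n%:R * `|x|.
Proof.
rewrite enorm_le ?mulr_ge0// /dot.
apply: (@le_trans _ _ (\sum_(i < n) `|x| ^+ 2)).
  apply: ler_sum => i _; rewrite -expr2 -(real_normK (num_real _)).
  by rewrite ler_sqr ?nnegrE// coord_le_norm.
rewrite sumr_const card_ord -[leLHS]mulr_natl exprMn ler_wpM2r ?sqr_ge0//.
by rewrite -natrX ler_nat; case: (n) => // m; rewrite leq_pmulr.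
Qed.

Lemma enorm_mulmx A x : enorm (A *m x) <= (n%:R * n%:R * `|A|) * enorm x.
Proof.
apply: le_trans (enorm_le_norm _) _.
rewrite -!mulrA ler_wpM2l// [leLHS]/Num.norm /= mx_normrE.
apply/bigmax_leP; split=> [|[i j] _ /=].
  by rewrite !mulr_ge0 ?enorm_ge0.
rewrite mxE; apply: le_trans (ler_norm_sum _ _ _) _.
apply: (@le_trans _ _ (\sum_(k < n) `|A| * enorm x)).
  apply: ler_sum => k _; rewrite normrM ord1.
  by rewrite ler_pM// ?coord_le_norm// enorm_coord.
by rewrite sumr_const card_ord -[leLHS]mulr_natl.
Qed.

End Euclid.

(** * Continuity and compactness *)

Section Topology.
Variables (R : realType) (T : topologicalType).

Lemma continuous_to_mx m p (f : T -> 'M[R]_(m, p)) :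
  (forall i j, continuous (fun t => f t i j)) -> continuous f.
Proof.
move=> cf t; apply/cvgrPdist_lt => e e0.
near=> s; rewrite [ltLHS]/Num.norm /= mx_normrE; apply/bigmax_ltP; split=> //.
move=> [i j] _ /=; rewrite !mxE; move: i j; near: s.
apply: filter_forall => i; apply: filter_forall => j.
by have /cvgrPdist_lt/(_ _ e0) := cf i j t.
Unshelve. all: by end_near. Qed.

Lemma continuous_coord m p (f : T -> 'M[R]_(m, p)) i j :
  continuous f -> continuous (fun t => f t i j).
Proof.
move=> cf t; apply: (@continuous_comp _ _ _ f (fun A : 'M[R]_(m, p) => A i j)).
  exact: cf.
exact: coord_continuous.
Qed.

Lemma continuous_mul (f g : T -> R) :
  continuous f -> continuous g -> continuous (fun t => f t * g t).
Proof. by move=> cf cg t; apply: continuousM; [exact: cf|exact: cg]. Qed.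

Lemma continuous_add (f g : T -> R) :
  continuous f -> continuous g -> continuous (fun t => f t + g t).
Proof. by move=> cf cg t; apply: continuousD; [exact: cf|exact: cg]. Qed.

Lemma continuous_sub (f g : T -> R) :
  continuous f -> continuous g -> continuous (fun t => f t - g t).
Proof. by move=> cf cg t; apply: continuousB; [exact: cf|exact: cg]. Qed.

Lemma continuous_sub_mx m p (f g : T -> 'M[R]_(m, p)) :
  continuous f -> continuous g -> continuous (fun t => f t - g t).
Proof. by move=> cf cg t; apply: continuousB; [exact: cf|exact: cg]. Qed.

Lemma continuous_bigD I (r : seq I) (f : I -> T -> R) :
  (forall i, continuous (f i)) -> continuous (fun t => \sum_(i <- r) f i t).
Proof. by move=> cf; apply: continuous_big => //; exact: add_continuous. Qed.

Lemma continuous_bigM I (r : seq I) (f : I -> T -> R) :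
  (forall i, continuous (f i)) -> continuous (fun t => \prod_(i <- r) f i t).
Proof. by move=> cf; apply: continuous_big => //; exact: mul_continuous. Qed.

Lemma continuous_dot n (f g : T -> 'cV[R]_n) :
  continuous f -> continuous g -> continuous (fun t => dot (f t) (g t)).
Proof.
move=> cf cg; apply: continuous_bigD => i t.
by apply: continuousM; exact: continuous_coord.
Qed.

Lemma continuous_mulmx m n p (f : T -> 'M[R]_(m, n)) (g : T -> 'M[R]_(n, p)) :
  continuous f -> continuous g -> continuous (fun t => f t *m g t).
Proof.
move=> cf cg; apply: continuous_to_mx => i j.
under eq_fun do rewrite mxE.
apply: continuous_bigD => k t.
by apply: continuousM; exact: continuous_coord.
Qed.

Lemma continuous_det n (f : T -> 'M[R]_n) :
  continuous f -> continuous (fun t => \det (f t)).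
Proof.
move=> cf; apply: continuous_bigD => s.
apply: continuous_mul; first exact: cst_continuous.
by apply: continuous_bigM => i; exact: continuous_coord.
Qed.

(** Compactness turns pointwise strict inequalities into uniform ones; the
    margin obtained here absorbs the second-order terms of the perturbation
    arguments below. *)
Lemma compact_pos_lbound (f : T -> R) (A : set T) :
  compact A -> continuous f -> (forall t, A t -> 0 < f t) ->
  exists2 d, 0 < d & forall t, A t -> d <= f t.
Proof.
move=> cA cf f0; have [A0|/set0P/negP/negPn/eqP A0] := pselect (A !=set0).
  have [|c /set_mem Ac fc] := compact_EVT_min A0 cA (f := f).
    exact: continuous_subspaceT.
  by exists (f c) => [|t At]; [exact: f0|apply: fc; exact: mem_set].
by exists 1 => // t; rewrite A0.
Qed.

End Topology.

Lemma compact_norm_ball (R : realType) m p (M : R) :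
  compact [set A : 'M[R]_(m, p) | `|A| <= M].
Proof.
pose S := [set v : 'rV[R]_(m * p) |
  forall i, [set x : R | - M <= x <= M] (v ord0 i)].
have cS : compact S.
  apply: (@rV_compact R _ (fun=> [set x : R | - M <= x <= M])) => _.
  have := @segment_compact R (- M) M; rewrite set_itvE; apply.
have : compact ((fun v : 'rV[R]_(m * p) => vec_mx v : 'M[R]_(m, p)) @` S).
  apply: continuous_compact cS; apply: continuous_subspaceT.
  apply: continuous_to_mx => i j; under eq_fun do rewrite mxE.
  exact: coord_continuous.
move=> cB; apply: (subclosed_compact _ cB).
  rewrite (_ : mkset _
    = (fun A : 'M[R]_(m, p) => `|A|) @^-1` [set x | x <= M])//.
  by apply: preimage_closed => // A _; exact: norm_continuous.
move=> A /= AM; exists (mxvec A); last by rewrite mxvecK.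
move=> i; rewrite /= -ler_norml; case/mxvec_indexP: i => i j.
by rewrite mxvecE; exact: le_trans (coord_le_norm _ _ _) AM.
Qed.

(** * Separation, polarity, diameter and inradius *)

Section Separation.
Variables (R : realType) (n : nat).
Implicit Types (x y z u v w c : 'cV[R]_n) (K : set 'cV[R]_n).

Lemma convex_setE K : convex_set K ->
  forall x y (t : R), K x -> K y -> 0 <= t <= 1 -> K (t *: x + (1 - t) *: y).
Proof.
move=> cK x y t Kx Ky /andP[t0 t1].
have t01 : Itv.spec (@Itv.num_sem R) (Itv.Real `[0%Z, 1%Z]) t.
  by apply/andP; split; rewrite ?num_real// in_itv /= t0 t1.
have := cK x y (Itv.mk t01) (mem_set Kx) (mem_set Ky).
by rewrite inE.
Qed.

(** The hyperplane through the point of [K] nearest to [z], orthogonal to the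
    segment from that point to [z]. *)
Lemma separation K z : compact K -> convex_set K -> K !=set0 -> ~ K z ->
  exists2 w, w != 0 & forall x, K x -> dot x w <= dot z w - dot w w.
Proof.
move=> cK /convex_setE vK K0 Kz.
pose f x := dot (z - x) (z - x).
have cB : continuous (fun x => z - x).
  by move=> x; apply: continuousB; [exact: cst_continuous|exact: cvg_id].
have [|k /set_mem Kk kmin] := compact_EVT_min K0 cK (f := f).
  by apply: continuous_subspaceT; exact: continuous_dot.
exists (z - k).
  by apply/negP => /eqP/subr0_eq zk; apply: Kz; rewrite zk.
move=> x Kx.
suff : dot (x - k) (z - k) <= 0.
  by rewrite !dotE (dotC k z); lra.
rewrite leNgt; apply/negP => a0.
set a := dot _ _ in a0; pose b := dot (x - k) (x - k).
have b0 : 0 <= b := dot_ge0 _.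
have ab0 : 0 < a + b by lra.
(* Moving from [k] towards [x] by a fraction [t] changes the squared distance
   to [z] by [t * (t * b - 2 * a)], negative for this [t]. *)
pose t := a / (a + b).
have tab : t * (a + b) = a by rewrite /t mulfVK// gt_eqF.
have t01 : 0 <= t <= 1.
  by rewrite /t divr_ge0 ?ler_pdivrMr ?mul1r//=; lra.
have t0 : 0 < t by rewrite divr_gt0.
have := kmin _ (mem_set (vK x k t Kx Kk t01)).
have -> : f (t *: x + (1 - t) *: k) = f k - 2 * t * a + t ^+ 2 * b.
  rewrite /f /a /b.
  have -> : z - (t *: x + (1 - t) *: k) = (z - k) - t *: (x - k).
    by apply/matrixP => i j; rewrite !mxE; ring.
  by rewrite !(dotDl (z - k)) !(dotDr (z - k)) !(dotNl, dotNr, dotZl, dotZr)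
    (dotC (z - k) (x - k)); ring.
move=> h; have : 0 <= t * (t * b - 2 * a) by nra.
by rewrite pmulr_rge0//; nra.
Qed.

(** A point of the ball outside [K] would be separated from [K] by a
    hyperplane, against the comparison of support functions along its normal. *)
Lemma eball_sub K c (rho : R) : compact K -> convex_set K -> K !=set0 ->
  (forall w, exists2 x, K x & dot c w + rho * enorm w <= dot x w) ->
  eball c rho `<=` K.
Proof.
move=> cK vK K0 h z zB; apply: contrapT => Kz.
have [w w0 hw] := separation cK vK K0 Kz.
have [x /hw hx cx] := h w.
have : dot (z - c) w <= rho * enorm w.
  apply: le_trans (cauchy_schwarz _ _) _.
  by rewrite ler_wpM2r ?enorm_ge0.
by have := dot_gt0 w0; rewrite !dotE; lra.
Qed.

Definition polar K : set 'cV[R]_n := [set u | forall x, K x -> dot x u <= 1].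

(** Half of the bipolar theorem: a body around the origin is the intersection
    of the half-spaces indexed by its polar. *)
Lemma bipolar_sub K z : compact K -> convex_set K -> eball 0 1 `<=` K ->
  (forall u, polar K u -> dot z u <= 1) -> K z.
Proof.
move=> cK vK BK h; apply: contrapT => Kz.
have K0 : K !=set0 by exists 0; apply: BK; rewrite /= /eball /= subr0 enorm0.
have [w w0 hw] := separation cK vK K0 Kz.
have wp := enorm_gt0 w0.
pose s := dot z w - dot w w.
have s0 : 0 < s.
  apply: lt_le_trans (hw ((enorm w)^-1 *: w) _).
    by rewrite dot_normalized.
  by apply: BK; rewrite /eball /= subr0 enorm_normalized.
have /h : polar K (s^-1 *: w).
  by move=> x /hw; rewrite dotZr mulrC ler_pdivrMr// mul1r.
rewrite dotZr mulrC ler_pdivrMr// mul1r /s.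
by have := dot_gt0 w0; lra.
Qed.

Lemma polar_norm K u : eball 0 1 `<=` K -> polar K u -> dot u u <= 1.
Proof.
move=> BK Ku; have [->|u0] := eqVneq u 0; first by rewrite dot0l.
have up := enorm_gt0 u0.
have : dot ((enorm u)^-1 *: u) u <= 1.
  by apply: Ku; apply: BK; rewrite /eball /= subr0 enorm_normalized.
rewrite dot_normalized// -sqr_enorm expr2 => u1.
by rewrite -[leRHS]mulr1 ler_pM// ltW.
Qed.

Lemma compact_polar K : eball 0 1 `<=` K -> compact (polar K).
Proof.
move=> BK; apply: (subclosed_compact _ (@compact_norm_ball R n 1 1)).
  rewrite (_ : polar K = \bigcap_(x in K) ((dot x) @^-1` [set a | a <= 1])).
    apply: closed_bigI => x _; apply: preimage_closed => // u _.
    by apply: continuous_dot; [exact: cst_continuous|move=> ?; exact: cvg_id].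
  by apply/seteqP; split=> u Ku x; exact: Ku.
move=> u /(polar_norm BK) u1 /=; apply: le_trans (norm_le_enorm _) _.
by rewrite enorm_le// expr1n.
Qed.

End Separation.

Section Bodies.
Variables (R : realType) (n : nat).
Implicit Types (x y z c : 'cV[R]_n) (K : set 'cV[R]_n).

Definition ebounded K := exists M : R, forall x, K x -> enorm x <= M.

Lemma compact_ebounded K : compact K -> ebounded K.
Proof.
move=> /compact_bounded/ex_strict_bound_gt0[k k0 hk].
exists (n%:R * k) => x Kx; apply: le_trans (enorm_le_norm _) _.
by rewrite ler_wpM2l// ltW// hk.
Qed.

Lemma interior_eball K : interior K !=set0 ->
  exists c, exists2 rho : R, 0 < rho & eball c rho `<=` K.
Proof.
move=> [c /nbhs_ballP[e /= e0 cK]]; exists c; exists (e / 2); first lra.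
move=> x; rewrite /eball /= => xc; apply: cK.
rewrite -ball_normE /= distrC.
by apply: (le_lt_trans (le_trans (norm_le_enorm _) xc)); lra.
Qed.

Lemma le_diameter K x y : ebounded K -> K x -> K y ->
  enorm (x - y) <= diameter K.
Proof.
move=> [M hM] Kx Ky; apply: ub_le_sup; last by exists x, y.
exists (M + M) => d [u [v [/hM uM /hM vM ->]]].
by apply: le_trans (enormD _ _) _; rewrite enormN lerD.
Qed.

Lemma diameter_le K (b : R) : K !=set0 ->
  (forall x y, K x -> K y -> enorm (x - y) <= b) -> diameter K <= b.
Proof.
move=> [x Kx] h; apply: ge_sup; first by exists (enorm (x - x)), x, x.
by move=> d [u [v [Ku Kv ->]]]; exact: h.
Qed.

Lemma eball_center c (rho : R) : 0 <= rho -> eball c rho c.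
Proof. by move=> rho0; rewrite /eball /= subrr enorm0. Qed.

Lemma eball_translate c v (rho : R) : enorm v <= rho -> eball c rho (c + v).
Proof. by move=> vr; rewrite /eball /= addrC addKr. Qed.

Lemma unit_vector : (0 < n)%N -> exists e : 'cV[R]_n, enorm e = 1.
Proof.
by move=> n0; exists (delta_mx (Ordinal n0) ord0); exact: enorm_delta.
Qed.

Lemma le_inradius K c (rho : R) : (0 < n)%N -> ebounded K -> 0 <= rho ->
  eball c rho `<=` K -> rho <= inradius K.
Proof.
move=> n0 [M hM] rho0 cK; apply: ub_le_sup; last by split=> //; exists c.
have [e e1] := unit_vector n0.
exists M => r [r0 [d dK]].
have p : eball d r (d + r *: e).
  by apply: eball_translate; rewrite enormZ e1 mulr1 ger0_norm.
have m : eball d r (d - r *: e).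
  by apply: eball_translate; rewrite enormN enormZ e1 mulr1 ger0_norm.
have := enormD (d + r *: e) (- (d - r *: e)).
have -> : d + r *: e - (d - r *: e) = (2 * r) *: e.
  by apply/matrixP => i j; rewrite !mxE; ring.
rewrite enormN enormZ e1 ger0_norm ?mulr_ge0//.
by have := hM _ (dK _ p); have := hM _ (dK _ m); lra.
Qed.

Lemma inradius_le K (b : R) : K !=set0 ->
  (forall c (rho : R), 0 <= rho -> eball c rho `<=` K -> rho <= b) ->
  inradius K <= b.
Proof.
move=> [x Kx] h; apply: ge_sup; last by move=> r [r0 [c cK]]; exact: h cK.
exists 0; split=> //; exists x => y; rewrite /eball /= => yx.
have /enorm_eq0/subr0_eq -> // : enorm (y - x) = 0.
by apply/eqP; rewrite eq_le yx enorm_ge0.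
Qed.

Lemma inradius_ge0 K : (0 < n)%N -> ebounded K -> K !=set0 -> 0 <= inradius K.
Proof.
move=> n0 bK [x Kx]; apply: (le_inradius (c := x)) => // y; rewrite /eball /=.
move=> yx; have /enorm_eq0/subr0_eq -> // : enorm (y - x) = 0.
by apply/eqP; rewrite eq_le yx enorm_ge0.
Qed.

Lemma diameter_ge0 K : ebounded K -> K !=set0 -> 0 <= diameter K.
Proof.
by move=> bK [x Kx]; exact: le_trans (enorm_ge0 (x - x)) (le_diameter bK Kx Kx).
Qed.

Lemma ratio_mono (D1 D2 r1 r2 : R) :
  0 <= D1 -> D1 <= D2 -> 0 < r2 -> r2 <= r1 ->
  D1 / (2 * r1) <= D2 / (2 * r2).
Proof.
move=> D0 D12 r0 r12; rewrite ler_pM ?invr_ge0//; first by lra.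
by rewrite lef_pV2 ?posrE; lra.
Qed.

Lemma ratio_le K c (B rho : R) : (0 < n)%N -> ebounded K -> 0 < rho ->
  eball c rho `<=` K ->
  (forall x y, K x -> K y -> dot (x - y) (x - y) <= B) ->
  diameter K / (2 * inradius K) <= Num.sqrt B / (2 * rho).
Proof.
move=> n0 bK rho0 cK hB; have K0 : K !=set0.
  by exists c; apply: cK; apply: eball_center; exact: ltW.
apply: ratio_mono => //; first exact: diameter_ge0.
  apply: diameter_le => // x y Kx Ky.
  by rewrite enormE ler_wsqrtr ?hB.
by apply: le_inradius cK => //; exact: ltW.
Qed.

End Bodies.

Section LinearImages.
Variables (R : realType) (n : nat).
Implicit Types (x y : 'cV[R]_n) (K : set 'cV[R]_n) (A : 'M[R]_n).

Lemma convex_setP K :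
  (forall x y (t : R), K x -> K y -> 0 <= t <= 1 ->
    K (t *: x + (1 - t) *: y)) ->
  convex_set K.
Proof.
move=> h x y t /set_mem Kx /set_mem Ky; apply/mem_set.
by apply: (h x y t%:num) => //; rewrite ge0 le1.
Qed.

Lemma ebounded_image A K : ebounded K -> ebounded (linear_image A K).
Proof.
move=> [M hM]; exists (n%:R * n%:R * `|A| * M) => _ [x Kx <-].
by apply: le_trans (enorm_mulmx _ _) _; rewrite ler_wpM2l ?mulr_ge0// hM.
Qed.

Lemma compact_image A K : compact K -> compact (linear_image A K).
Proof.
move=> cK; apply: continuous_compact cK; apply: continuous_subspaceT.
apply: continuous_mulmx; first exact: cst_continuous.
by move=> ?; exact: cvg_id.
Qed.

Lemma convex_image A K : convex_set K -> convex_set (linear_image A K).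
Proof.
move=> vK; apply: convex_setP => _ _ t [x Kx <-] [y Ky <-] t01.
exists (t *: x + (1 - t) *: y); first exact: convex_setE.
by rewrite mulmxDr -!scalemxAr.
Qed.

End LinearImages.

(** * First-order conditions for a maximal ellipsoid *)

Section Determinant.
Variable R : realType.

Lemma char_polyE m (S : 'M[R]_m) x : \det (x%:M - S) = (char_poly S).[x].
Proof.
rewrite /char_poly -horner_evalE -det_map_mx; congr (\det _).
apply/matrixP => i j; rewrite !mxE /= /horner_eval hornerD hornerN hornerC.
by case: (i == j); rewrite ?mulr1n ?mulr0n ?hornerX ?hornerC.
Qed.

(** The derivative of the determinant at the identity is the trace: both are
    read off the characteristic polynomial, whose two leading coefficients are
    [1] and [- \tr S]. *)
Lemma det_perturb n (S : 'M[R]_n) : (0 < n)%N -> 0 < \tr S ->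
  exists2 t0, 0 < t0 & forall t, 0 < t -> t <= t0 -> 1 < \det (1%:M + t *: S).
Proof.
case: n S => // m S _ trS.
pose p := char_poly S.
have pm : p`_m = - \tr S by have := char_poly_trace S isT.
have pm1 : p`_m.+1 = 1.
  by have /monicP := char_poly_monic S; rewrite lead_coefE size_char_poly.
pose C := \sum_(i < m) `|p`_i|.
have C0 : 0 <= C by apply: sumr_ge0.
exists (Num.min 1 (\tr S / (C + 1))) => [|t t0].
  by rewrite lt_min ltr01 divr_gt0//; lra.
rewrite le_min ler_pdivlMr => [/andP[t1 tC]|]; last by lra.
have -> : 1%:M + t *: S = (- t) *: ((- t^-1)%:M - S).
  rewrite scalerBr scale_scalar_mx mulrNN mulfV ?gt_eqF//.
  by rewrite scaleNr opprK.
have ab k : (- t) ^+ k * (- t^-1) ^+ k = 1.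
  by rewrite -exprMn mulrNN mulfV ?gt_eqF// expr1n.
rewrite detZ char_polyE -/p horner_coef size_char_poly mulr_sumr.
rewrite big_ord_recr /= pm1 mul1r ab.
rewrite big_ord_recr /= pm.
have -> : (- t) ^+ m.+1 * (- \tr S * (- t^-1) ^+ m) = t * \tr S.
  rewrite exprS -[RHS]mulr1 -(ab m); ring.
set s := \sum_(i < m) _.
have : `|s| <= t ^+ 2 * C.
  rewrite /C mulr_sumr; apply: le_trans (ler_norm_sum _ _ _) _.
  apply: ler_sum => i _.
  have -> : (- t) ^+ m.+1 = (- t) ^+ (m - i).+1 * (- t) ^+ i.
    by rewrite -exprD addSn subnK// ltnW.
  rewrite mulrCA -mulrA ab mulr1.
  rewrite normrM mulrC ler_wpM2r// normrX normrN gtr0_norm//.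
  by apply: ler_wiXn2l; rewrite ?ltnS ?subn_gt0// ltW.
rewrite ler_norml => /andP[h _].
have : 0 < t * (\tr S - t * C) by rewrite mulr_gt0//; nra.
by nra.
Qed.

End Determinant.

Section John.
Variables (R : realType) (n : nat) (n_gt0 : (0 < n)%N).
Implicit Types (x y z u v w c : 'cV[R]_n) (K : set 'cV[R]_n).

(** The unit ball, when it lies in [K], has the largest volume among the
    ellipsoids in [K]; [\det S] is the signed relative volume of the image of
    the ball under [S]. *)
Definition ball_maximal K := forall c (S : 'M[R]_n),
  (forall b, enorm b <= 1 -> K (c + S *m b)) -> \det S <= 1.

Lemma exists_small (a b : R) : 0 < a -> 0 < b ->
  exists t, [/\ 0 < t, t <= a & t <= b].
Proof.
move=> a0 b0; exists (Num.min a b).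
by rewrite lt_min a0 b0 !ge_min !lexx orbT.
Qed.

(** First-order optimality of the unit ball. At a unit vector [u] the support
    function of the ellipsoid [t c + (1 + t S) B] is
    [1 + t (<c, u> + <u, S u>) + O(t^2)]. If the first-order term were negative
    at all contact normals, the ellipsoid would lie in [K] for small [t], while
    its volume exceeds that of the ball because [\tr S > 0]. Used with suitable
    pairs [(c, S)], this plays the part of John's decomposition of the
    identity. *)
Lemma john_contact K c (S : 'M[R]_n) :
  compact K -> convex_set K -> eball 0 1 `<=` K -> ball_maximal K ->
  0 < \tr S ->
  exists u, [/\ polar K u, dot u u = 1 & 0 <= dot c u + dot u (S *m u)].
Proof.
move=> cK vK BK mK trS; apply: contrapT => nex.
pose q u := dot c u + dot u (S *m u).
(* A vector of the polar is either of norm less than 1, or a contact normal,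
   where [q] is negative. *)
pose g u := Num.max (1 - dot u u) (- q u).
have cid : continuous (fun u : 'cV[R]_n => u) by move=> ?; exact: cvg_id.
have cdot : continuous (fun u : 'cV[R]_n => 1 - dot u u).
  apply: continuous_sub; first exact: cst_continuous.
  exact: (continuous_dot cid cid).
have cq : continuous (fun u => - q u).
  move=> u; apply: continuousN; move: u; apply: continuous_add.
    by apply: continuous_dot => //; exact: cst_continuous.
  apply: continuous_dot => //; apply: continuous_mulmx => //.
  exact: cst_continuous.
have cg : continuous g by exact: (max_fun_continuous cdot cq).
have [u Ku|d d0 hd] := compact_pos_lbound (compact_polar BK) cg.
  rewrite lt_max; have := polar_norm BK Ku; rewrite le_eqVlt.
  case/predU1P => [u1|u1]; last by rewrite subr_gt0 u1.
  apply/orP; right; rewrite oppr_gt0 ltNge; apply/negP => q0.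
  by apply: nex; exists u; split.
have u1 u : polar K u -> enorm u <= 1.
  by move=> /(polar_norm BK); rewrite enorm_le// expr1n.
pose N := n%:R * n%:R * `|S|; pose N' := n%:R * n%:R * `|S^T|.
have N0 : 0 <= N by rewrite !mulr_ge0.
have N'0 : 0 <= N' by rewrite !mulr_ge0.
have cu u : polar K u -> dot c u <= enorm c.
  move=> /u1 hu; apply: le_trans (cauchy_schwarz _ _) _.
  by rewrite ler_piMr ?enorm_ge0.
have qu u : polar K u -> q u <= enorm c + N.
  move=> Ku; rewrite lerD ?cu//; apply: le_trans (cauchy_schwarz _ _) _.
  have := enorm_mulmx S u; have := u1 _ Ku; rewrite -/N => h1 h2.
  rewrite -[leRHS]mul1r ler_pM ?enorm_ge0//; apply: le_trans h2 _.
  by rewrite ler_piMr.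
have Su u : polar K u -> dot (S^T *m u) (S^T *m u) <= N' ^+ 2.
  move=> /u1 hu; rewrite -enorm_le//; apply: le_trans (enorm_mulmx _ _) _.
  by rewrite ler_piMr.
have [t1 t10 ht1] := det_perturb n_gt0 trS.
have c0 := enorm_ge0 c.
pose Q := enorm c + N.
have Q0 : 0 <= Q by rewrite addr_ge0.
have [t2 [t20 t21 t2c]] : exists t, [/\ 0 < t, t <= t1 & t <= (enorm c + 1)^-1].
  by apply: exists_small; rewrite // invr_gt0; lra.
have [t3 [t30 t32 t31]] : exists t, [/\ 0 < t, t <= t2 & t <= 1].
  exact: exists_small.
have C0 : 0 < 2 * Q + N' ^+ 2 + 1 by have := sqr_ge0 N'; lra.
have [t [t0 t3' td]] :
    exists t, [/\ 0 < t, t <= t3 & t <= d / (2 * Q + N' ^+ 2 + 1)].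
  by apply: exists_small; rewrite // divr_gt0.
have t_1 : t <= 1 by lra.
have tc : t * enorm c <= 1.
  have : t <= (enorm c + 1)^-1 by lra.
  by rewrite -div1r ler_pdivlMr; lra.
move: td; rewrite ler_pdivlMr// => td.
suff : \det (1%:M + t *: S) <= 1 by have := ht1 t t0; lra.
apply: (mK (t *: c)) => b b1; apply: bipolar_sub => // u Ku.
rewrite dotDl dotZl dot_mulmx.
have -> : (1%:M + t *: S)^T *m u = u + t *: (S^T *m u).
  by rewrite linearD/= linearZ/= trmx1 mulmxDl mul1mx scalemxAl.
set v := u + _.
have : dot b v <= enorm v.
  apply: le_trans (cauchy_schwarz _ _) _.
  by rewrite ler_piMl ?enorm_ge0.
suff : enorm v <= 1 - t * dot c u by lra.
have tcu : t * dot c u <= 1.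
  by apply: le_trans tc; rewrite ler_pM2l// cu.
rewrite enorm_le; last by lra.
have -> : dot v v = dot u u + 2 * t * dot u (S *m u)
                    + t ^+ 2 * dot (S^T *m u) (S^T *m u).
  by rewrite /v !dotE (dotC (S^T *m u) u) -dot_mulmx (dotC (S *m u)); ring.
have := Su _ Ku; have := qu _ Ku; have := polar_norm BK Ku.
have := hd _ Ku; rewrite /g le_max /q -/Q /=.
set a := dot c u; set e := dot u (S *m u); set f := dot u u.
set h := dot (S^T *m u) _.
move=> dg f1 qQ hN.
have hN' : t ^+ 2 * h <= t * (t * N' ^+ 2).
  by rewrite expr2 -mulrA ler_pM2l// ler_pM2l.
have tN : t * N' ^+ 2 <= d - 2 * (t * Q) - t by nra.
have ta : 0 <= (t * a) ^+ 2 := sqr_ge0 _.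
have tQ : 0 <= t * Q by rewrite mulr_ge0// ltW.
have tt : t * (t * N' ^+ 2) <= t * (d - 2 * (t * Q) - t) by rewrite ler_pM2l.
have tNN : t * (t * N' ^+ 2) <= t * N' ^+ 2.
  by rewrite ler_piMl// mulr_ge0 ?sqr_ge0// ltW.
have tqq : t * (a + e) <= t * Q by rewrite ler_pM2l.
case/orP: dg => dg; first by nra.
have : t * d <= t * (- (a + e)) by rewrite ler_pM2l.
have : 0 <= t * (t * Q) by rewrite mulr_ge0// ltW.
by nra.
Qed.
End John.

(** * Bodies in John position *)

Section JohnPosition.
Variables (R : realType) (n : nat) (n_gt0 : (0 < n)%N).
Implicit Types (x y z u v w c : 'cV[R]_n) (K : set 'cV[R]_n).

Lemma trace_rank1 v w : \tr (v *m w^T) = dot v w.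
Proof. by rewrite mxtrace_mulC /mxtrace big_ord1 -dot_mx dotC. Qed.

Lemma mul_rank1 v w u : (v *m w^T) *m u = dot w u *: v.
Proof.
rewrite -mulmxA [w^T *m u]mx11_scalar -dot_mx mul_mx_scalar.
by [].
Qed.

Definition john_position K :=
  [/\ compact K, convex_set K, eball 0 1 `<=` K & ball_maximal K].

(** On contact normals the form [(1 - <x, u>) (1 - <y, u>)] is nonnegative. If
    [<x, y> < - n], its negative, less a small positive constant, is the
    first-order term of a deformation of the ball that increases the volume. *)
Lemma john_dot K x y : john_position K -> K x -> K y -> - n%:R <= dot x y.
Proof.
move=> [cK vK BK mK] Kx Ky; rewrite leNgt; apply/negP => xyn.
have n0 : 0 < n%:R :> R by rewrite ltr0n.
(* Any [al] with [1 < al < q / n] would do. *)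
pose q := - dot x y; pose al := (1 + q / n%:R) / 2.
have qn : n%:R < q by rewrite /q; lra.
have al1 : 1 < al.
  have : 1 < q / n%:R by rewrite ltr_pdivlMr// mul1r.
  by rewrite /al; lra.
pose S := - (x *m y^T) - al%:M : 'M[R]_n.
have [|u [Ku u1]] := john_contact n_gt0 (x + y) (S := S) cK vK BK mK.
  rewrite /S linearB linearN /= trace_rank1 mxtrace_scalar -/q -mulr_natr /al.
  have -> : q - (1 + q / n%:R) / 2 * n%:R = (q - n%:R) / 2.
    by field; rewrite gt_eqF.
  by lra.
rewrite /S mulmxBl mulNmx mul_rank1 mul_scalar_mx !dotE u1.
have := Ku _ Kx; have := Ku _ Ky; rewrite (dotC u x).
set a := dot x u; set b := dot y u => b1 a1.
have : 0 <= (1 - a) * (1 - b) by rewrite mulr_ge0// subr_ge0.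
nra.
Qed.

(** Apply [john_dot] to [x] and the point of the unit sphere opposite to it. *)
Lemma john_norm K x : john_position K -> K x -> enorm x <= n%:R.
Proof.
move=> jK Kx; have [->|x0] := eqVneq x 0; first by rewrite enorm0.
have /(john_dot jK Kx) : K (- ((enorm x)^-1 *: x)).
  case: jK => _ _ BK _; apply: BK.
  by rewrite /eball /= subr0 enormN enorm_normalized.
by rewrite dotNr dotC dot_normalized// lerN2.
Qed.

Lemma john_sqr K x : john_position K -> K x -> dot x x <= n%:R ^+ 2.
Proof. by move=> jK Kx; rewrite -enorm_le// (john_norm jK Kx). Qed.

Lemma john_diam K x y : john_position K -> K x -> K y ->
  dot (x - y) (x - y) <= 2 * n%:R * (n%:R + 1).
Proof.
move=> jK Kx Ky; rewrite !dotE (dotC y x).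
have := john_dot jK Kx Ky; have := john_sqr jK Kx; have := john_sqr jK Ky.
by nra.
Qed.

(** A point [v] of maximal norm forces a contact normal at [- v / n]. Indeed
    [- n <= <v, u> <= 1] on contact normals [u], and likewise for [w], so that
    [(1 - <v, u>) (n + <v, u>) + (1 - <w, u>) (n + <w, u>)] is nonnegative
    there, whereas its quadratic and constant parts balance in trace. Adding the
    linear term [e <v, u>] singles out contact normals with [<v, u> <= 0], at
    one of which the sum is at most [e / 4], whence [u] is close to [- v / n].
    The second product then shows that [<- v / n, w>] is [1] or [- n], and the
    latter means [v = w]. *)
Lemma john_extreme K v w : john_position K -> K v -> K w ->
  dot v v = n%:R ^+ 2 -> dot w w = n%:R ^+ 2 -> v != w -> dot v w = - n%:R.
Proof.
move=> jK Kv Kw vn wn vw.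
have [cK vK BK mK] := jK.
have n1 : 1 <= n%:R :> R by rewrite ler1n.
have n0 : 0 < n%:R :> R by lra.
pose be := - dot v w / n%:R.
have vwE : dot v w = - (n%:R * be) by rewrite /be mulrC divfK ?opprK// gt_eqF.
have be1 : be <= 1.
  by rewrite /be ler_pdivrMr// mul1r lerNl (john_dot jK).
have bv : dot v w ^+ 2 <= n%:R ^+ 2 * n%:R ^+ 2.
  by rewrite -{1}vn -wn cauchy_schwarz_sqr.
have ben : - n%:R < be.
  rewrite ltNge; apply/negP => h; case/negP: vw; apply/eqP/subr0_eq/dot_eq0.
  apply/eqP; rewrite eq_le dot_ge0 andbT !dotE (dotC w v) vn wn vwE.
  by nra.
suff ga0 : (1 - be) * (n%:R + be) <= 0.
  have be_1 : be = 1 by apply/eqP; rewrite eq_le be1 /=; nra.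
  by rewrite vwE be_1 mulr1.
rewrite leNgt; apply/negP => ga0.
set ga := _ * _ in ga0.
(* [C * d] bounds the total error below, for [e = d ^ 2]. *)
pose C : R := n%:R + 1 + 6 * n%:R ^+ 2.
have C0 : 0 < C by rewrite /C; nra.
have [d [d0 d1 dC]] : exists d : R, [/\ 0 < d, d <= 1 & d <= ga / (2 * C)].
  apply: exists_small; first exact: ltr01.
  by rewrite divr_gt0// mulr_gt0.
have {}dC : d * C < ga.
  move: dC; rewrite ler_pdivlMr; last by lra.
  by have := mulr_gt0 d0 C0; lra.
pose e := d ^+ 2.
have e0 : 0 < e by rewrite /e exprn_gt0.
have e1 : e <= d by rewrite /e; nra.
pose S := v *m v^T + w *m w^T - (2 * n%:R - e / 4)%:M : 'M[R]_n.
pose c := (n%:R - 1 - e) *: v + (n%:R - 1) *: w.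
have [|u [Ku u1]] := john_contact n_gt0 c (S := S) cK vK BK mK.
  rewrite /S linearB linearD /= !trace_rank1 mxtrace_scalar vn wn.
  by rewrite -mulr_natr; nra.
rewrite /S /c mulmxBl mulmxDl !mul_rank1 mul_scalar_mx.
rewrite !dotE u1 (dotC u v) (dotC u w).
have := Ku _ Kv; have := Ku _ Kw.
have := cauchy_schwarz_sqr v u; have := cauchy_schwarz_sqr w u.
rewrite vn wn u1 mulr1.
have : (dot w u - be) ^+ 2 <= n%:R ^+ 2 * (2 * (1 + dot v u / n%:R)).
  have -> : dot w u - be = dot w (u + n%:R^-1 *: v).
    by rewrite /be !dotE (dotC w v); ring.
  have -> : 2 * (1 + dot v u / n%:R)
      = dot (u + n%:R^-1 *: v) (u + n%:R^-1 *: v).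
    by rewrite !dotE (dotC u v) u1 vn; field; rewrite gt_eqF.
  by rewrite -wn cauchy_schwarz_sqr.
set a := dot v u; set b := dot w u => hb bn2 an2 b1 a1 h.
have an : - n%:R <= a by nra.
have bn : - n%:R <= b by nra.
have f0 : (1 - a) * (n%:R + a) + (1 - b) * (n%:R + b) + e * a <= e / 4 by nra.
have fb : 0 <= (1 - b) * (n%:R + b) by rewrite mulr_ge0//; lra.
have fa : 0 <= (1 - a) * (n%:R + a) by rewrite mulr_ge0//; lra.
have a0 : a <= 0.
  rewrite leNgt; apply/negP => a0.
  have [a2|a2] := leP a (1 / 2); last by nra.
  have : 1 / 2 <= (1 - a) * (n%:R + a) by nra.
  by nra.
have na : n%:R + a <= e * (n%:R + 1).
  have : n%:R + a <= (1 - a) * (n%:R + a) by nra.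
  by nra.
have nb : (1 - b) * (n%:R + b) <= e * (n%:R + 1) by nra.
have hb2 : (b - be) ^+ 2 <= (2 * n%:R * d) ^+ 2.
  apply: le_trans hb _.
  have -> : n%:R ^+ 2 * (2 * (1 + a / n%:R)) = 2 * n%:R * (n%:R + a).
    by field; rewrite gt_eqF.
  have -> : (2 * n%:R * d) ^+ 2 = 2 * n%:R * (e * (2 * n%:R)).
    by rewrite /e; ring.
  rewrite ler_pM2l; last by lra.
  by apply: le_trans na _; rewrite ler_pM2l//; lra.
have {}hb2 : `|b - be| <= 2 * n%:R * d.
  have nd : 0 <= 2 * n%:R * d by rewrite !mulr_ge0// ltW.
  by rewrite -ler_sqr ?nnegrE// real_normK ?num_real.
have hg : ga - (1 - b) * (n%:R + b) = (b - be) * (n%:R - 1 + b + be).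
  by rewrite /ga; ring.
have h3 : `|n%:R - 1 + b + be| <= 3 * n%:R by rewrite ler_norml; lra.
have : (b - be) * (n%:R - 1 + b + be) <= 2 * n%:R * d * (3 * n%:R).
  by apply: le_trans (ler_norm _) _; rewrite normrM ler_pM.
have : e * (n%:R + 1) <= d * (n%:R + 1) by rewrite ler_pM2r//; lra.
by rewrite /C in dC; nra.
Qed.

End JohnPosition.

(** * Families of vertices of a regular simplex *)

Section Frames.
Variables (R : realType) (n : nat) (n_gt0 : (0 < n)%N).
Implicit Types (x y z u w c : 'cV[R]_n) (K : set 'cV[R]_n).

Lemma convex_comb K : convex_set K ->
  forall k (p : 'I_k -> 'cV[R]_n) (l : 'I_k -> R),
    (forall i, K (p i)) -> (forall i, 0 <= l i) -> \sum_i l i = 1 ->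
    K (\sum_i l i *: p i).
Proof.
move=> /convex_setE vK; elim=> [|k IH] p l Kp l0.
  by rewrite big_ord0 => /eqP; rewrite eq_sym oner_eq0.
rewrite !big_ord_recr /=; set s := \sum_(i < k) _; set a := l ord_max => sa.
have s0 : 0 <= s by apply: sumr_ge0.
have a0 : 0 <= a := l0 _.
have [s_0|sn0] := eqVneq s 0.
  have li0 i : l (widen_ord (leqnSn k) i) = 0.
    by apply: (psumr_eq0P _ s_0).
  rewrite big1 => [|i _]; last by rewrite li0 scale0r.
  by rewrite add0r (_ : a = 1) ?scale1r//; lra.
pose l' i := l (widen_ord (leqnSn k) i) / s.
have -> : \sum_(i < k) l (widen_ord (leqnSn k) i) *: p (widen_ord (leqnSn k) i)
        = s *: \sum_(i < k) l' i *: p (widen_ord (leqnSn k) i).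
  rewrite scaler_sumr; apply: eq_bigr => i _.
  by rewrite scalerA /l' mulrC divfK.
rewrite (_ : a = 1 - s); last by lra.
apply: vK => //; last by lra.
apply: IH => // [i|]; first by rewrite divr_ge0.
by rewrite -mulr_suml -/s mulfV.
Qed.

Variables (k : nat) (v : 'I_k -> 'cV[R]_n).
Local Notation c := (n%:R * (n%:R + 1) : R).
(* The Gram matrix of [k] vertices of a regular simplex circumscribed about the
   unit ball. *)
Hypothesis gram : forall i j, dot (v i) (v j) = c * (i == j)%:R - n%:R.

Let n1 : 1 <= n%:R :> R. Proof. by rewrite ler1n. Qed.
Let c0 : 0 < c. Proof. by rewrite mulr_gt0 ?ltr0n//; lra. Qed.

Lemma gram_row j : dot (\sum_i v i) (v j) = c - k%:R * n%:R.
Proof.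
rewrite dot_suml; under eq_bigr do rewrite gram.
rewrite sumrB sumr_const card_ord -[_ *+ k]mulr_natl -mulr_sumr (bigD1 j)//=.
rewrite eqxx.
by rewrite big1 ?addr0 ?mulr1// => i /negbTE ->.
Qed.

Lemma gram_sum :
  dot (\sum_i v i) (\sum_i v i) = k%:R * (n%:R * (n%:R + 1 - k%:R)).
Proof.
rewrite dot_sumr; under eq_bigr do rewrite gram_row.
by rewrite sumr_const card_ord -[LHS]mulr_natl; ring.
Qed.

Lemma gram_size : (k <= n.+1)%N.
Proof.
case: (posnP k) => [->//|k0].
have := dot_ge0 (\sum_i v i).
rewrite gram_sum pmulr_rge0 ?ltr0n// pmulr_rge0 ?ltr0n//.
by rewrite subr_ge0 natr1 ler_nat.
Qed.

Section Full.
Hypothesis kn : k = n.+1.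

Lemma gram_sum0 : \sum_i v i = 0.
Proof.
apply: dot_eq0; rewrite gram_sum (_ : k%:R = n%:R + 1) ?subrr ?mulr0//.
by rewrite kn -natr1.
Qed.

(** [c I - sum v_i v_i^T] is [c] times an orthogonal projection, by the Gram
    relations, and its trace vanishes for [n + 1] vectors. *)
Lemma tight_frame x : c *: x = \sum_i dot (v i) x *: v i.
Proof.
pose M := \sum_i v i *m (v i)^T.
have ME y : M *m y = \sum_i dot (v i) y *: v i.
  by rewrite mulmx_suml; apply: eq_bigr => i _; rewrite mul_rank1.
have Mv j : M *m v j = c *: v j.
  rewrite ME; under eq_bigr do rewrite gram scalerBl.
  rewrite sumrB -scaler_sumr gram_sum0 scaler0 subr0 (bigD1 j)//= eqxx mulr1.
  by rewrite big1 ?addr0// => i /negbTE ->; rewrite mulr0 scale0r.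
have MM : M *m M = c *: M.
  rewrite {2 3}/M mulmx_sumr scaler_sumr; apply: eq_bigr => j _.
  by rewrite mulmxA Mv scalemxAl.
have Mtr : M^T = M.
  rewrite /M raddf_sum; apply: eq_bigr => i _ /=.
  by rewrite trmx_mul trmxK.
pose Q := c%:M - M.
have QT : Q^T = Q by rewrite /Q [LHS]linearB /= tr_scalar_mx Mtr.
have QQ : Q^T *m Q = c *: Q.
  rewrite QT /Q mulmxBl !mulmxBr MM.
  rewrite !mul_scalar_mx mul_mx_scalar !scalerBr !scale_scalar_mx.
  by rewrite subrr subr0.
have trQ : \tr Q = 0.
  have trM : \tr M = \sum_(i < k) n%:R ^+ 2.
    rewrite /M raddf_sum; apply: eq_bigr => i _ /=.
    by rewrite trace_rank1 gram eqxx mulr1; ring.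
  rewrite /Q linearB /= mxtrace_scalar trM sumr_const card_ord kn.
  by rewrite -[_ *+ n]mulr_natl -[_ *+ n.+1]mulr_natl -natr1; ring.
have Q0 : Q = 0.
  have : \tr (Q^T *m Q) = 0 by rewrite QQ mxtraceZ trQ mulr0.
  rewrite /mxtrace; under eq_bigr do rewrite mxE.
  move=> h; apply/matrixP => i j; rewrite [RHS]mxE.
  have hj : \sum_l Q^T j l * Q l j = 0.
    apply: (psumr_eq0P _ h) => // a _; apply: sumr_ge0 => b _.
    by rewrite mxE -expr2 sqr_ge0.
  have : Q^T j i * Q i j = 0.
    by apply: (psumr_eq0P _ hj) => // a _; rewrite [Q^T _ _]mxE -expr2 sqr_ge0.
  by rewrite [Q^T j i]mxE => /eqP; rewrite mulf_eq0 orbb => /eqP.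
by rewrite -ME -mul_scalar_mx; apply/subr0_eq; rewrite -mulmxBl -/Q Q0 mul0mx.
Qed.

(** The simplex of the [p i] is cut out by the inequalities
    [- n <= <p i, x>], which [john_dot] provides on all of [K]. *)
Lemma full_frame_simplex K : john_position K -> (forall i, K (v i)) ->
  is_simplex K.
Proof.
move: v gram tight_frame gram_sum0; rewrite kn => p gr tf s0 jK Kp.
have [_ vK _ _] := jK.
exists p; split.
  move=> l l1 lp j.
  have : dot (\sum_i l i *: p i) (p j) = 0 by rewrite lp dot0l.
  rewrite dot_suml; under eq_bigr do rewrite dotZl gr mulrBr.
  rewrite sumrB -mulr_suml l1 mul0r subr0 (bigD1 j)//= eqxx mulr1.
  rewrite big1 => [|i /negbTE ->]; last by rewrite !mulr0.
  by rewrite addr0 => /eqP; rewrite mulf_eq0 (gt_eqF c0) orbF => /eqP.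
apply/seteqP; split=> [x Kx|_ [l [l0 l1 ->]]]; last exact: convex_comb.
exists (fun i => (dot (p i) x + n%:R) / c); split.
- move=> i; rewrite divr_ge0 ?(ltW c0)// -lerBlDr sub0r.
  by rewrite (john_dot n_gt0 jK (Kp i) Kx).
- rewrite -mulr_suml big_split/= -dot_suml s0 dot0l add0r sumr_const card_ord.
  have -> : n%:R *+ n.+1 = c by rewrite -[LHS]mulr_natl -natr1; ring.
  by rewrite mulfV// gt_eqF.
- have -> : \sum_i (dot (p i) x + n%:R) / c *: p i
      = c^-1 *: (\sum_i dot (p i) x *: p i + n%:R *: \sum_i p i).
    rewrite scaler_sumr -big_split scaler_sumr; apply: eq_bigr => i _ /=.
    by rewrite -scalerDl scalerA mulrC.
  by rewrite s0 scaler0 addr0 -tf scalerA mulVf ?scale1r// gt_eqF.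
Qed.

End Full.

Definition centroid := k%:R^-1 *: \sum_i v i.
(** The orthogonal projection onto the span of the differences [v i - v j]. *)
Definition frame_proj : 'M[R]_n :=
  c^-1 *: \sum_i (v i - centroid) *m (v i - centroid)^T.
Local Notation m := centroid.
Local Notation P := frame_proj.

Lemma frame_projE x : P *m x = c^-1 *: \sum_i dot (v i - m) x *: (v i - m).
Proof.
rewrite /P -scalemxAl mulmx_suml; congr (_ *: _).
by apply: eq_bigr => i _; rewrite mul_rank1.
Qed.

Lemma frame_proj_tr : P^T = P.
Proof.
rewrite /P linearZ /= raddf_sum; congr (_ *: _); apply: eq_bigr => i _ /=.
by rewrite trmx_mul trmxK.
Qed.

Lemma sum_centered : \sum_i (v i - m) = 0.
Proof.
rewrite sumrB sumr_const card_ord /m -scaler_nat scalerA.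
have [k0|k0] := posnP k; last first.
  by rewrite mulfV ?scale1r ?subrr// pnatr_eq0 -lt0n.
by rewrite !big1 ?scaler0 ?subrr// => i; have := ltn_ord i; rewrite {2}k0.
Qed.

Lemma dot_centered i j : dot (v i - m) (v j - m) = c * ((i == j)%:R - k%:R^-1).
Proof.
have k0 : k%:R != 0 :> R by rewrite pnatr_eq0; case: (k) i => [[]|].
rewrite /m !dotE (dotC (v i) (\sum_i _)) !gram_row gram_sum gram.
by field.
Qed.

Lemma dot_centered_centroid i : dot (v i - m) m = 0.
Proof.
have k0 : k%:R != 0 :> R by rewrite pnatr_eq0; case: (k) i => [[]|].
rewrite /m !dotE (dotC (v i)) gram_row gram_sum.
by field.
Qed.

Lemma frame_proj_centered j : P *m (v j - m) = v j - m.
Proof.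
rewrite frame_projE; under eq_bigr do rewrite dot_centered -scalerA scalerBl.
rewrite -scaler_sumr sumrB -scaler_sumr sum_centered scaler0 subr0.
rewrite scalerA mulVf ?gt_eqF// scale1r (bigD1 j)//= eqxx scale1r.
by rewrite big1 ?addr0// => i /negbTE ->; rewrite scale0r.
Qed.

Lemma frame_proj_diff i j : P *m (v i - v j) = v i - v j.
Proof.
have -> : v i - v j = (v i - m) - (v j - m) by rewrite opprB addrA subrK.
by rewrite mulmxBr !frame_proj_centered.
Qed.

Lemma frame_proj_idem : P *m P = P.
Proof.
rewrite {2 3}/P -scalemxAr mulmx_sumr; congr (_ *: _); apply: eq_bigr => i _.
by rewrite mulmxA frame_proj_centered.
Qed.

Lemma dot_proj x y : dot (P *m x) (P *m y) = dot (P *m x) y.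
Proof.
by rewrite dotC dot_mulmx frame_proj_tr mulmxA frame_proj_idem dotC.
Qed.

Lemma dot_proj_sum x : c * dot (P *m x) x = \sum_i dot (v i - m) x ^+ 2.
Proof.
rewrite frame_projE dotZl mulrA mulfV ?gt_eqF// mul1r dot_suml.
by apply: eq_bigr => i _; rewrite dotZl expr2.
Qed.

Lemma proj_centroid : P *m m = 0.
Proof.
rewrite frame_projE big1 ?scaler0// => i _.
by rewrite dot_centered_centroid scale0r.
Qed.

(** For [1 < k <= n] the simplex of the [v i] has, within its affine hull, an
    inradius whose square [n (n + 1) / (k (k - 1))] exceeds 1. A unit vector of
    the span of the differences therefore exceeds 1 on some [v i], and is not in
    the polar. *)
Lemma polar_proj_lt1 K u : (k <= n)%N -> eball 0 1 `<=` K ->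
  (forall i, K (v i)) -> polar K u -> dot (P *m u) (P *m u) < 1.
Proof.
move=> kn BK Kv Ku; have u1 := polar_norm BK Ku.
have pu := dot_ge0 (u - P *m u).
have := dot_proj u u; move: pu; rewrite !dotE (dotC u (P *m u)) => pu pp.
rewrite ltNge; apply/negP => pu1.
have /dot_eq0/subr0_eq uP : dot (u - P *m u) (u - P *m u) = 0.
  by apply/eqP; rewrite eq_le dot_ge0 andbT !dotE (dotC u (P *m u)); lra.
have mu : dot m u = 0.
  by rewrite uP -{1}frame_proj_tr -dot_mulmx proj_centroid dot0l.
have a1 i : dot (v i - m) u <= 1.
  by rewrite dotDl dotNl mu subr0; exact: Ku.
have sa : \sum_i dot (v i - m) u = 0.
  by rewrite -dot_suml sum_centered dot0l.
have ak i : - (k%:R - 1) <= dot (v i - m) u.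
  move: sa; rewrite (bigD1 i)//= => /eqP; rewrite addr_eq0 => /eqP ->.
  rewrite lerN2; apply: le_trans (ler_sum _ (fun j _ => a1 j)) _.
  by rewrite sumr_const cardC1 card_ord -subn1 natrB//; case: (k) i => [[]|].
(* The coefficients [a i = <v i - m, u>] have sum 0 and lie between
   [- (k - 1)] and 1, which bounds the sum of their squares by [k (k - 1)]. *)
have : 0 <= \sum_i (1 - dot (v i - m) u) * (dot (v i - m) u + (k%:R - 1)).
  apply: sumr_ge0 => i _; rewrite mulr_ge0//.
    by have := a1 i; lra.
  by have := ak i; lra.
have -> : \sum_i (1 - dot (v i - m) u) * (dot (v i - m) u + (k%:R - 1))
   = (2 - k%:R) * \sum_i dot (v i - m) u + k%:R * (k%:R - 1)
     - \sum_i dot (v i - m) u ^+ 2.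
  rewrite mulr_sumr.
  have -> : k%:R * (k%:R - 1) = \sum_(i < k) (k%:R - 1) :> R.
    by rewrite sumr_const card_ord -[RHS]mulr_natl.
  rewrite -big_split -sumrB; apply: eq_bigr => i _ /=; ring.
rewrite sa mulr0 add0r -dot_proj_sum.
have cP : c <= c * dot (P *m u) u by rewrite ler_peMr ?(ltW c0)// -dot_proj.
have kR : k%:R <= n%:R :> R by rewrite ler_nat.
have k0 : 0 <= k%:R :> R by [].
have : 0 <= (n%:R - k%:R) * (n%:R + k%:R - 1) :> R.
  apply: mulr_ge0; first by rewrite subr_ge0.
  by rewrite -addrA addrCA addr_ge0// subr_ge0.
move: cP n1; set N : R := n%:R; set k' : R := k%:R; set d := dot _ u.
clearbody N k' d => h1 h2 h3 h4.
by clear -h1 h2 h3 h4; nra.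
Qed.

End Frames.

(** * Decreasing the ratio of a body that is not a simplex *)

Section NotSimplex.
Variables (R : realType) (n : nat) (n_gt0 : (0 < n)%N).
Implicit Types (x y z u w c : 'cV[R]_n) (K : set 'cV[R]_n).

Lemma sqrt_ratio (b l : R) : 0 < b -> 0 < l ->
  Num.sqrt b / (2 * (Num.sqrt l)^-1) = Num.sqrt (2^-1 ^+ 2 * (b * l)).
Proof.
move=> b0 l0.
rewrite sqrtrM ?sqr_ge0// sqrtr_sqr ger0_norm ?invr_ge0// sqrtrM ?(ltW b0)//.
by field; rewrite gt_eqF// sqrtr_gt0.
Qed.

Definition extreme_seq K (s : seq 'cV[R]_n) :=
  uniq s /\ forall x, x \in s -> K x /\ dot x x = n%:R ^+ 2.

Lemma extreme_gram K s : john_position K -> extreme_seq K s ->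
  forall i j : 'I_(size s), dot s`_i s`_j
    = n%:R * (n%:R + 1) * (i == j)%:R - n%:R.
Proof.
move=> jK [us hs] i j.
have [Ki ni] := hs s`_i (mem_nth _ (ltn_ord i)).
have [Kj nj] := hs s`_j (mem_nth _ (ltn_ord j)).
have [->|ij] := eqVneq i j; first by rewrite nj mulr1; ring.
rewrite mulr0 sub0r; apply: (john_extreme n_gt0 jK) => //.
by rewrite nth_uniq.
Qed.

Lemma maximal_extreme_seq K : john_position K -> exists s,
  extreme_seq K s /\ forall x, K x -> dot x x = n%:R ^+ 2 -> x \in s.
Proof.
move=> jK.
pose p k := `[< exists s, size s = k /\ extreme_seq K s >].
have p0 : exists k, p k by exists 0%N; apply/asboolP; exists [::].
have pmax k : p k -> (k <= n.+1)%N.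
  move=> /asboolP[s [<- es]]; exact: (gram_size n_gt0 (extreme_gram jK es)).
case: (ex_maxnP p0 pmax) => k /asboolP[s [sk [us hs]]] kmax.
exists s; split=> // x Kx xn; apply: contraT => xs.
suff /kmax : p k.+1 by rewrite ltnn.
apply/asboolP; exists (x :: s); rewrite /= sk; split=> //; split.
  by rewrite /= xs.
by move=> y; rewrite inE => /predU1P[->//|/hs].
Qed.

(** A maximal family of points of norm [n] has at most [n + 1] members, and
    exactly [n + 1] only for a simplex. Otherwise let [P] be the projection onto
    the span of their differences and apply [(1 + t P)^-1]. Differences
    [x - y] of the maximal squared length [2 n (n + 1)] join points of norm [n],
    hence lie in that span, so the bound on the diameter shrinks by the factor
    [1 + t] up to an arbitrarily small multiple of [t]. The inradius shrinks by
    a smaller factor to first order, because [|P u|^2 <= 1 - eta] on the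
    polar. *)
Lemma john_not_simplex K : john_position K -> ~ is_simplex K ->
  exists2 A : 'M[R]_n, A \in unitmx &
    diameter (linear_image A K) / (2 * inradius (linear_image A K))
      < Num.sqrt ((n * n.+1)%:R / 2).
Proof.
move=> jK nsK; have [cK vK BK mK] := jK.
have [s [es smax]] := maximal_extreme_seq jK.
have gr := extreme_gram jK es.
pose v (i : 'I_(size s)) := s`_i.
have Kv i : K (v i) by have [_ /(_ _ (mem_nth 0 (ltn_ord i)))[]] := es.
have n1 : 1 <= n%:R :> R by rewrite ler1n.
have kn : (size s <= n)%N.
  have := gram_size n_gt0 gr; rewrite leq_eqVlt ltnS => /predU1P[sn|//].
  by case: nsK; exact: (full_frame_simplex n_gt0 gr sn jK Kv).
pose P := frame_proj v.
pose N : R := 2 * n%:R * (n%:R + 1).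
have N0 : 0 < N by rewrite /N; nra.
have cid : continuous (fun u : 'cV[R]_n => u) by move=> ?; exact: cvg_id.
have cP : continuous (fun u => P *m u).
  by apply: continuous_mulmx => //; exact: cst_continuous.
have [|u Ku|eta eta0 heta] := compact_pos_lbound (compact_polar BK)
    (f := fun u => 1 - dot (P *m u) (P *m u)).
- apply: continuous_sub; first exact: cst_continuous.
  exact: continuous_dot.
- by rewrite subr_gt0; exact: (polar_proj_lt1 n_gt0 gr kn BK).
have eta1 : eta <= 1.
  have : polar K 0 by move=> x _; rewrite dot0r.
  by move=> /heta; rewrite mulmx0 dot0l subr0.
(* Differences are either shorter than the maximum, or nearly in the range of
   [P]. *)
pose g (xy : 'cV[R]_n * 'cV[R]_n) :=
  let d := xy.1 - xy.2 in
  Num.max (N - dot d d) (eta * N / 2 - dot (d - P *m d) d).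
have [|[x y] [/= Kx Ky]|de de0 hde] := compact_pos_lbound (compact_setX cK cK)
    (f := g).
- have cd : continuous (fun xy : 'cV[R]_n * 'cV[R]_n => xy.1 - xy.2).
    exact: sub_continuous.
  have cQ : continuous (fun xy : 'cV[R]_n * 'cV[R]_n =>
      (xy.1 - xy.2) - P *m (xy.1 - xy.2)).
    apply: continuous_sub_mx; first exact: cd.
    by apply: continuous_mulmx; [exact: cst_continuous|exact: cd].
  apply: max_fun_continuous.
    apply: continuous_sub; first exact: cst_continuous.
    exact: (continuous_dot cd cd).
  apply: continuous_sub; first exact: cst_continuous.
  exact: (continuous_dot cQ cd).
- rewrite /g /= lt_max; have := john_diam n_gt0 jK Kx Ky; rewrite -/N.
  rewrite le_eqVlt => /predU1P[dN|]; last by rewrite subr_gt0 => ->.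
  apply/orP; right.
  have x2 := john_sqr n_gt0 jK Kx; have y2 := john_sqr n_gt0 jK Ky.
  have xy := john_dot n_gt0 jK Kx Ky.
  have [xn yn] : dot x x = n%:R ^+ 2 /\ dot y y = n%:R ^+ 2.
    by move: dN; rewrite !dotE (dotC y x) /N; split; apply/eqP;
      rewrite eq_le ?x2 ?y2 /=; nra.
  have /(nthP 0)[i si xi] := smax _ Kx xn.
  have /(nthP 0)[j sj yj] := smax _ Ky yn.
  have -> : P *m (x - y) = x - y.
    rewrite -xi -yj.
    exact: (frame_proj_diff n_gt0 gr (Ordinal si) (Ordinal sj)).
  by rewrite subrr dot0l subr0 divr_gt0// mulr_gt0.
(* [(1 + t) ^ 2 = 1 + si] is the factor on squared lengths in the range of
   [P]. *)
have [t [t0 t1 tN]] : exists t : R, [/\ 0 < t, t <= 1 / 4 & t <= de / (3 * N)].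
  by apply: exists_small; rewrite divr_gt0// mulr_gt0.
have PP : P *m P = P := frame_proj_idem n_gt0 gr.
have PT : P^T = P := frame_proj_tr v.
have pd x y : dot (P *m x) (P *m y) = dot (P *m x) y := dot_proj n_gt0 gr x y.
clearbody P.
pose si := 2 * t + t ^+ 2.
have si0 : 0 < si by rewrite /si; nra.
have si1 : si < 1 by rewrite /si; nra.
have siN : si * N <= de.
  have : t * (3 * N) <= de by rewrite -ler_pdivlMr// mulr_gt0.
  have : si <= 3 * t by rewrite /si; nra.
  by nra.
pose th := t / (1 + t).
have t10 : 1 + t != 0 by rewrite gt_eqF//; lra.
pose A : 'M[R]_n := 1%:M - th *: P.
pose A' : 'M[R]_n := 1%:M + t *: P.
have AA' : A *m A' = 1%:M.
  rewrite /A /A' mulmxBl mul1mx -scalemxAl mulmxDr mulmx1.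
  rewrite -scalemxAr PP scalerDr scalerA opprD -addrA.
  rewrite (_ : t *: P + _ = (t - th - th * t) *: P); last first.
    by rewrite !scalerBl addrA.
  rewrite (_ : t - th - th * t = 0) ?scale0r ?addr0//.
  by rewrite /th; field.
have uA : A \in unitmx by have [] := mulmx1_unit AA'.
have A'T : A'^T = A' by rewrite /A' linearD /= linearZ /= trmx1 PT.
have A'u u : polar K u -> dot (A' *m u) (A' *m u) <= 1 + si * (1 - eta).
  move=> Ku; rewrite /A' mulmxDl mul1mx -scalemxAl !dotE (dotC u) pd.
  have := heta _ Ku; rewrite pd; have := polar_norm BK Ku.
  by rewrite /si; move: si0; rewrite /si; nra.
have Ad d : (1 + si) * dot (A *m d) (A *m d)
    = dot d d + si * dot (d - P *m d) d.
  rewrite /A mulmxBl mul1mx -scalemxAl !dotE (dotC d (P *m d)) pd.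
  by rewrite /si /th; field.
pose L := 1 + si * (1 - eta).
have L0 : 0 < L by rewrite /L; nra.
pose B := N * (1 + si * eta / 2) / (1 + si).
exists A => //.
apply: le_lt_trans (@ratio_le R n _ 0 B (Num.sqrt L)^-1 n_gt0 _ _ _ _) _.
- exact/ebounded_image/compact_ebounded.
- by rewrite invr_gt0 sqrtr_gt0.
- move=> y; rewrite /eball /= subr0 => hy.
  exists (A' *m y); last by rewrite mulmxA AA' mul1mx.
  apply: bipolar_sub => // u Ku; rewrite dot_mulmx A'T.
  apply: le_trans (cauchy_schwarz _ _) _.
  have hu : enorm (A' *m u) <= Num.sqrt L.
    by rewrite enormE ler_wsqrtr ?A'u.
  rewrite -(@mulVf _ (Num.sqrt L)) ?gt_eqF ?sqrtr_gt0//.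
  by rewrite ler_pM ?enorm_ge0.
- move=> _ _ [x Kx <-] [y Ky <-]; rewrite -mulmxBr.
  have dN := john_diam n_gt0 jK Kx Ky; rewrite -/N in dN.
  set d := x - y in dN *.
  rewrite /B ler_pdivlMr; last by lra.
  rewrite mulrC Ad.
  have dd : dot (d - P *m d) d <= dot d d.
    by have := dot_ge0 (P *m d); rewrite pd !dotE; lra.
  have := hde (x, y) (conj Kx Ky); rewrite /g /= -/d le_max.
  have eN : 0 < si * (eta * N) by rewrite mulr_gt0// mulr_gt0.
  by case/orP => h; nra.
have B0 : 0 < B by rewrite divr_gt0// ?mulr_gt0//; nra.
rewrite sqrt_ratio//.
rewrite ltr_sqrt; last by rewrite divr_gt0// ltr0n muln_gt0 n_gt0.
have -> : (n * n.+1)%:R / 2 = 2^-1 ^+ 2 * N :> R.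
  by rewrite natrM -natr1 /N; field.
rewrite ltr_pM2l ?exprn_gt0//.
rewrite /B mulrAC ltr_pdivrMr; last by lra.
rewrite -[ltLHS]mulrA ltr_pM2l// /L.
have se : 0 < si * eta by rewrite mulr_gt0.
have s1 : 0 < 1 - si * (1 - eta) by nra.
have := mulr_gt0 se s1; nra.
Qed.


End NotSimplex.

(** * Existence of the maximal ellipsoid and of the optimal image *)

Section JohnEllipsoid.
Variables (R : realType) (n : nat).
Implicit Types (x y z u w c : 'cV[R]_n) (K : set 'cV[R]_n).

Lemma mx_norm_le_enorm (G : 'M[R]_n) (M : R) : 0 <= M ->
  (forall x, enorm x <= 1 -> enorm (G *m x) <= M) -> `|G| <= M.
Proof.
move=> M0 h; rewrite [leLHS]/Num.norm /= mx_normrE.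
apply/bigmax_leP; split=> // -[i j] _ /=.
apply: le_trans (h (delta_mx j ord0) _); last by rewrite enorm_delta.
apply: le_trans (enorm_coord _ i).
by rewrite -colE mxE.
Qed.

(** An ellipsoid of maximal volume exists because the pairs [(G, c)] with
    [c + G B] inside [K] form a compact set; it is invertible since [K] contains
    a ball, and pulling [K] back along it makes it the unit ball. *)
Lemma john_ellipsoid K : convex_body K -> exists (G : 'M[R]_n) c,
  G \in unitmx /\ john_position [set y | K (c + G *m y)].
Proof.
move=> [cK vK iK]; have [M hM] := compact_ebounded cK.
have [c0 [rho rho0 cK0]] := interior_eball iK.
pose E := [set Gc : 'M[R]_n * 'cV[R]_n |
  forall b, enorm b <= 1 -> K (Gc.2 + Gc.1 *m b)].
have c1 : continuous (fun Gc : 'M[R]_n * 'cV[R]_n => Gc.1).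
  by move=> ?; exact: cvg_fst.
have c2 : continuous (fun Gc : 'M[R]_n * 'cV[R]_n => Gc.2).
  by move=> ?; exact: cvg_snd.
have EK G c : E (G, c) -> K c.
  move=> /(_ 0); rewrite enorm0 /= mulmx0 addr0; exact.
have clK : closed K by apply: compact_closed cK; exact: norm_hausdorff.
have cE : compact E.
  have cMK := compact_setX (@compact_norm_ball R n n (M + M)) cK.
  apply: (subclosed_compact _ cMK).
    rewrite (_ : E = \bigcap_(b in [set b | enorm b <= 1])
        ((fun Gc : 'M[R]_n * 'cV[R]_n => Gc.2 + Gc.1 *m b) @^-1` K)).
      apply: closed_bigI => b _; apply: preimage_closed => // Gc _.
      apply: continuousD; first exact: c2.
      by apply: continuous_mulmx => //; exact: cst_continuous.
    by apply/seteqP; split=> Gc h b; exact: h.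
  move=> [G c] EG; split; last exact: EK EG.
  have Kc := EK _ _ EG; have cM := hM _ Kc.
  apply: mx_norm_le_enorm => [|b b1].
    by apply: addr_ge0; apply: le_trans (enorm_ge0 c) cM.
  have -> : G *m b = (c + G *m b) - c by rewrite addrC addKr.
  by apply: le_trans (enormD _ _) _; rewrite enormN lerD// hM//; exact: EG.
have E0 : E (rho%:M, c0).
  move=> b b1; apply: cK0; apply: eball_translate.
  by rewrite mul_scalar_mx enormZ gtr0_norm// ler_piMr// ltW.
have [||[G c] /set_mem EG Gmax] := compact_EVT_max
  (f := fun Gc : 'M[R]_n * 'cV[R]_n => \det Gc.1) _ cE.
- by exists (rho%:M, c0).
- by apply: continuous_subspaceT; exact: continuous_det.
have dG : 0 < \det G.
  apply: lt_le_trans (Gmax _ (mem_set E0)).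
  by rewrite /= det_scalar exprn_gt0.
have uG : G \in unitmx by rewrite unitmxE unitfE gt_eqF.
exists G, c; split=> //; split.
- have -> : [set y | K (c + G *m y)] = (fun x => invmx G *m (x - c)) @` K.
    apply/seteqP; split=> [y Ky|_ [x Kx <-]] /=.
      by exists (c + G *m y); rewrite // addrC addKr mulKmx.
    by rewrite mulKVmx// addrC subrK.
  apply: continuous_compact cK; apply: continuous_subspaceT.
  apply: continuous_mulmx; first exact: cst_continuous.
  apply: continuous_sub_mx; last exact: cst_continuous.
  by move=> ?; exact: cvg_id.
- apply: convex_setP => x y t /= Kx Ky t01.
  have := convex_setE vK Kx Ky t01; congr K.
  rewrite mulmxDr -!scalemxAr.
  move: (G *m x) (G *m y) => gx gy.
  by apply/matrixP => i j; rewrite !mxE; ring.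
- by move=> b; rewrite /eball /= subr0 => /EG.
- move=> c' S hS.
  have : E (G *m S, c + G *m c').
    by move=> b /hS /=; rewrite mulmxDr mulmxA addrA.
  move=> /mem_set/Gmax /=; rewrite det_mulmx => h.
  by rewrite -(ler_pM2l dG) mulr1.
Qed.

End JohnEllipsoid.

Section Minimum.
Variables (R : realType) (n : nat) (n_gt0 : (0 < n)%N).
Implicit Types (x y z u w c : 'cV[R]_n) (K : set 'cV[R]_n) (A B : 'M[R]_n).

Lemma continuous_lipschitz (V : normedModType R) (f : V -> R) (C : R) :
  0 <= C ->
  (forall a b, f a <= f b + C * `|a - b|) -> continuous f.
Proof.
move=> C0 h a; apply/cvgrPdist_lt => e e0.
have eC : 0 < e / (C + 1) by rewrite divr_gt0//; lra.
have /cvgrPdist_lt/(_ _ eC) : (fun b : V => b) @ a --> a by exact: cvg_id.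
apply: filterS => b; rewrite ltr_pdivlMr => [ab|]; last by lra.
have hab := h a b; have := h b a; rewrite distrC => hba.
have nab := normr_ge0 (a - b).
by rewrite ltr_norml; nra.
Qed.

Lemma diameter_lipschitz K (M : R) :
  K !=set0 -> (forall x, K x -> enorm x <= M) ->
  forall A B, diameter (linear_image A K)
    <= diameter (linear_image B K) + (2 * (n%:R * n%:R * M)) * `|A - B|.
Proof.
move=> [x0 Kx0] hM A B; apply: diameter_le; first by exists (A *m x0), x0.
move=> _ _ [x Kx <-] [y Ky <-].
have e z : K z -> enorm ((A - B) *m z) <= n%:R * n%:R * M * `|A - B|.
  move=> /hM zM; apply: le_trans (enorm_mulmx _ _) _.
  by rewrite mulrAC ler_wpM2r// ler_wpM2l// mulr_ge0.
have -> : A *m x - A *m y = (B *m x - B *m y) + ((A - B) *m x - (A - B) *m y).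
  by rewrite !mulmxBl addrACA -opprD !(addrC (B *m _)) !subrK.
apply: le_trans (enormD _ _) _; rewrite lerD//.
  apply: le_diameter; [|by exists x|by exists y].
  by apply: ebounded_image; exists M.
apply: le_trans (enormD _ _) _; rewrite enormN.
by have := e _ Kx; have := e _ Ky; lra.
Qed.

(** Shrinking a ball of the image by the displacement of the image keeps it
    inside the displaced image, by comparison of support functions. *)
Lemma inradius_lipschitz K (M : R) : compact K -> convex_set K -> K !=set0 ->
  (forall x, K x -> enorm x <= M) ->
  forall A B, inradius (linear_image A K)
    <= inradius (linear_image B K) + (n%:R * n%:R * M) * `|A - B|.
Proof.
move=> cK vK [x0 Kx0] hM A B.
have bB : ebounded (linear_image B K) by apply: ebounded_image; exists M.
have B0 : linear_image B K !=set0 by exists (B *m x0), x0.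
have rB := inradius_ge0 n_gt0 bB B0.
apply: inradius_le; first by exists (A *m x0), x0.
move=> c rho rho0 cA; set e := _ * `|A - B|.
have [|re] := leP rho e; first by lra.
rewrite -lerBlDr; apply: (le_inradius (c := c)) => //; first by lra.
apply: eball_sub => //; [exact: compact_image|exact: convex_image|].
move=> w; have [->|w0] := eqVneq w 0.
  by exists (B *m x0); [exists x0|rewrite !dot0r enorm0 mulr0 add0r].
have wp := enorm_gt0 w0.
have [|x Kx xE] := cA (c + rho *: ((enorm w)^-1 *: w)).
  by apply: eball_translate; rewrite enormZ enorm_normalized// mulr1 ger0_norm.
exists (B *m x); first by exists x.
have : dot ((A - B) *m x) w <= e * enorm w.
  apply: le_trans (cauchy_schwarz _ _) _; rewrite ler_wpM2r ?enorm_ge0//.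
  apply: le_trans (enorm_mulmx _ _) _.
  by rewrite /e mulrAC ler_wpM2r// ler_wpM2l ?mulr_ge0// hM.
by rewrite mulmxBl xE dotDl dotNl dotDl (dotZl rho) dot_normalized//; lra.
Qed.

Lemma diameter_gt0 K A c (rho : R) : ebounded K -> 0 < rho ->
  eball c rho `<=` K -> A != 0 -> 0 < diameter (linear_image A K).
Proof.
move=> bK rho0 cK A0.
have [j Aj] : exists j, A *m (delta_mx j ord0 : 'cV_n) != 0.
  apply: contrapT => h; case/negP: A0; apply/eqP/matrixP => i j.
  rewrite [RHS]mxE; apply/eqP/negPn/negP => Aij; apply: h; exists j.
  apply: contra Aij => /eqP/matrixP/(_ i ord0).
  by rewrite -colE !mxE => ->.
have ej := @enorm_delta R n j.
set d := delta_mx j ord0 in Aj ej.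
have Kd : K (c + rho *: d).
  apply: cK; apply: eball_translate; rewrite enormZ gtr0_norm//.
  by rewrite ej mulr1.
have Kc : K c by apply: cK; apply: eball_center; exact: ltW.
apply: (@lt_le_trans _ _ (enorm (A *m (c + rho *: d) - A *m c))).
  rewrite -mulmxBr addrAC subrr add0r -scalemxAr enormZ gtr0_norm//.
  by rewrite mulr_gt0// enorm_gt0.
by apply: le_diameter; [exact: ebounded_image|exists (c + rho *: d)|exists c].
Qed.

Lemma inradius_gt0 K A c (rho : R) : ebounded K -> 0 < rho ->
  eball c rho `<=` K -> A \in unitmx -> 0 < inradius (linear_image A K).
Proof.
move=> bK rho0 cK uA.
pose C := n%:R * n%:R * `|invmx A|.
have C0 : 0 <= C by rewrite !mulr_ge0.
have rC : 0 < rho / (C + 1) by rewrite divr_gt0//; lra.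
apply: lt_le_trans rC _; apply: (le_inradius (c := A *m c)) => //.
- exact: ebounded_image.
- by rewrite divr_ge0//; lra.
move=> y; rewrite /eball /= => hy.
exists (invmx A *m y); last by rewrite mulKVmx.
apply: cK; rewrite /eball /=.
have -> : invmx A *m y - c = invmx A *m (y - A *m c).
  by rewrite mulmxBr mulKmx.
apply: le_trans (enorm_mulmx _ _) _.
apply: (@le_trans _ _ (C * (rho / (C + 1)))); first by rewrite ler_wpM2l.
rewrite mulrA ler_pdivrMr; last by lra.
by nra.
Qed.

Lemma inradius_gt0_unitmx K A : K !=set0 -> 0 < inradius (linear_image A K) ->
  A \in unitmx.
Proof.
move=> [x0 Kx0]; apply: contraTT.
rewrite unitmxE unitfE negbK => /det0P[v v0 vA].
rewrite -leNgt; apply: inradius_le; first by exists (A *m x0), x0.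
move=> c rho rho0 cA; pose w := v^T.
have w0 : w != 0 by rewrite /w trmx_eq0.
have wp := enorm_gt0 w0.
have wA x : dot (A *m x) w = 0.
  by rewrite dotC dot_mx /w trmxK mulmxA vA mul0mx mxE.
have [x _ xE] := cA _ (eball_center c rho0).
have [|y _ yE] := cA (c + rho *: ((enorm w)^-1 *: w)).
  by apply: eball_translate; rewrite enormZ enorm_normalized// mulr1 ger0_norm.
have := wA y; rewrite yE dotDl (dotZl rho) dot_normalized// -xE wA add0r.
by move/eqP; rewrite mulf_eq0 (gt_eqF wp) orbF => /eqP ->.
Qed.

Lemma diameter_scale K A (a : R) : 0 < a -> ebounded K -> K !=set0 ->
  diameter (linear_image (a *: A) K) <= a * diameter (linear_image A K).
Proof.
move=> a0 bK [x0 Kx0]; apply: diameter_le; first by exists (a *: A *m x0), x0.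
move=> _ _ [x Kx <-] [y Ky <-].
rewrite -!scalemxAl -scalerBr enormZ gtr0_norm// ler_pM2l//.
by apply: le_diameter; [exact: ebounded_image|exists x|exists y].
Qed.

Lemma inradius_scale K A (a : R) : 0 < a -> ebounded K -> K !=set0 ->
  a * inradius (linear_image A K) <= inradius (linear_image (a *: A) K).
Proof.
move=> a0 bK [x0 Kx0]; rewrite mulrC -ler_pdivlMr//.
apply: inradius_le; first by exists (A *m x0), x0.
move=> c rho rho0 cA; rewrite ler_pdivlMr// mulrC.
apply: (le_inradius (c := a *: c)) => //.
- exact: ebounded_image.
- by rewrite mulr_ge0// ltW.
move=> y; rewrite /eball /= => hy.
have [|x Kx xE] := cA (a^-1 *: y).
  rewrite /eball /= -(ler_pM2l a0) -{1}(gtr0_norm a0) -enormZ scalerBr.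
  by rewrite scalerA mulfV ?scale1r// gt_eqF.
by exists x => //; rewrite -scalemxAl xE scalerA mulfV ?scale1r// gt_eqF.
Qed.

(** The ratio is invariant under dilations, and [inradius / diameter] is
    continuous in the nonzero matrix [A], singular ones included. Its maximum on
    the unit sphere of matrices is therefore attained; being positive, it is
    attained at an invertible matrix, since the inradius of a degenerate image
    vanishes. *)
Lemma ratio_min K : convex_body K -> exists m,
  is_minimum (diameter_inradius_ratios K) m.
Proof.
move=> [cK vK iK]; have bK := compact_ebounded cK; have [M hM] := bK.
have [c [rho rho0 cK0]] := interior_eball iK.
have Kc : K c by apply: cK0; apply: eball_center; exact: ltW.
have K0 : K !=set0 by exists c.
have M0 : 0 <= M by apply: le_trans (enorm_ge0 c) (hM _ Kc).
pose D A := diameter (linear_image A K).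
pose r A := inradius (linear_image A K).
have cD : continuous D.
  apply: (@continuous_lipschitz 'M[R]_n _ (2 * (n%:R * n%:R * M))).
    by rewrite !mulr_ge0.
  exact: diameter_lipschitz.
have cr : continuous r.
  apply: (@continuous_lipschitz 'M[R]_n _ (n%:R * n%:R * M)).
    by rewrite !mulr_ge0.
  exact: inradius_lipschitz.
pose S := [set A : 'M[R]_n | `|A| = 1].
have S0 A : S A -> A != 0.
  by move=> SA; rewrite -normr_eq0 SA oner_eq0.
have DS A : S A -> 0 < D A by move=> /S0; exact: diameter_gt0 cK0.
have cS : compact S.
  apply: (subclosed_compact _ (@compact_norm_ball R n n 1)); last first.
    by move=> A /= ->.
  rewrite (_ : S = (fun A : 'M[R]_n => `|A|) @^-1` [set 1])//.
  by apply: preimage_closed => // A _; exact: norm_continuous.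
have nS A : A \in unitmx -> 0 < `|A| /\ S (`|A|^-1 *: A).
  move=> uA; have A0 : 0 < `|A|.
    rewrite normr_gt0; apply: contraTN uA => /eqP ->.
    rewrite unitmxE -(scale0r 1%:M) detZ expr0n -leqn0 leqNgt n_gt0.
    by rewrite mul0r unitr0.
  split=> //; rewrite /S /= normrZ ger0_norm ?invr_ge0//.
  by rewrite mulVf// gt_eqF.
have [||A0 /set_mem SA0 A0max] :=
  compact_EVT_max (f := fun A => r A / D A) _ cS.
- by have [_ S1] := nS _ (unitmx1 R n); exists (`|1%:M : 'M[R]_n|^-1 *: 1%:M).
- apply: continuous_in_subspaceT => A /set_mem SA.
  apply: continuousM; first exact: cr.
  by apply: continuousV; [rewrite gt_eqF// DS|exact: cD].
have rpos A : A \in unitmx -> 0 < r A by exact: inradius_gt0 cK0.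
have scale A (a : R) : 0 < a -> A \in unitmx -> 0 < r (a *: A).
  move=> a0 uA; apply: lt_le_trans (inradius_scale A a0 bK K0).
  by rewrite mulr_gt0// rpos.
have rA0 : 0 < r A0.
  have [i0 S1] := nS _ (unitmx1 R n).
  have : 0 < r A0 / D A0.
    apply: lt_le_trans (A0max _ (mem_set S1)).
    by rewrite divr_gt0 ?DS ?scale ?invr_gt0// unitmx1.
  have := DS _ SA0 => hD.
  by rewrite pmulr_lgt0// invr_gt0.
have uA0 := inradius_gt0_unitmx K0 rA0.
exists (D A0 / (2 * r A0)); split; first by exists A0.
move=> _ [A uA <-]; rewrite -/(D A) -/(r A).
have [a0 S1] := nS _ uA.
set a := `|A|^-1 in S1; have {}a0 : 0 < a by rewrite invr_gt0.
have := A0max _ (mem_set S1).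
have := inradius_scale A a0 bK K0; have := diameter_scale A a0 bK K0.
rewrite -/(D A) -/(r A) -/(D (a *: A)) -/(r (a *: A)) => hD hr hmax.
apply: (@le_trans _ _ (D (a *: A) / (2 * r (a *: A)))).
  move: hmax; rewrite ler_pdivrMr ?DS// mulrAC ler_pdivlMr ?DS// => hmax.
  have r1 := scale _ _ a0 uA.
  rewrite ler_pdivrMr; last by lra.
  by rewrite mulrAC ler_pdivlMr; lra.
have -> : D A / (2 * r A) = (a * D A) / (2 * (a * r A)).
  by field; rewrite !gt_eqF// ?rpos.
apply: ratio_mono => //; last by rewrite mulr_gt0// rpos.
by apply: ltW; exact: DS.
Qed.

(** Carries bounds from the John normalisation [K'] over to [K]: the image of
    [K] under [A G^-1] is a translate of the image of [K'] under [A]. *)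
Lemma ratio_affine K (G : 'M[R]_n) c0 A c (rho : R) :
  let K' := [set y | K (c0 + G *m y)] in
  ebounded K -> ebounded K' -> 0 < rho -> eball c rho `<=` K' ->
  G \in unitmx -> A \in unitmx ->
  diameter (linear_image (A *m invmx G) K)
      / (2 * inradius (linear_image (A *m invmx G) K))
  <= diameter (linear_image A K') / (2 * inradius (linear_image A K')).
Proof.
move=> K' bK bK' rho0 cK' uG uA.
have Kc : K' c by apply: cK'; apply: eball_center; exact: ltW.
have K0 : linear_image (A *m invmx G) K !=set0.
  by exists (A *m invmx G *m (c0 + G *m c)), (c0 + G *m c).
have KK' x : K x -> K' (invmx G *m (x - c0)).
  by move=> Kx; rewrite /K' /= mulKVmx// addrC subrK.
apply: ratio_mono.
- by apply: diameter_ge0 => //; exact: ebounded_image.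
- apply: diameter_le => // _ _ [x Kx <-] [y Ky <-].
  have -> : A *m invmx G *m x - A *m invmx G *m y
      = A *m (invmx G *m (x - c0)) - A *m (invmx G *m (y - c0)).
    by rewrite -!mulmxA -!mulmxBr opprB addrA subrK.
  apply: le_diameter; first exact: ebounded_image.
    by exists (invmx G *m (x - c0)) => //; exact: KK'.
  by exists (invmx G *m (y - c0)) => //; exact: KK'.
- exact: inradius_gt0 cK' _.
- apply: inradius_le; first by exists (A *m c), c.
  move=> d s s0 dK'.
  apply: (le_inradius (c := d + A *m invmx G *m c0)) => //.
    exact: ebounded_image.
  move=> y; rewrite /eball /= => hy.
  have [|x Kx xE] := dK' (y - A *m invmx G *m c0).
    by rewrite /eball /= addrAC -addrA -opprD.
  exists (c0 + G *m x) => //.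
  by rewrite mulmxDr mulmxA mulmxKV// xE addrC subrK.
Qed.

End Minimum.

(** * The ratio of a simplex *)

Section SimplexBound.
Variables (R : realType) (n : nat) (n_gt0 : (0 < n)%N).
Implicit Types (x y z u w c : 'cV[R]_n).

Lemma sum_cauchy_schwarz m (a b : 'I_m -> R) : (forall i, 0 <= a i) ->
  (\sum_i a i * b i) ^+ 2 <= (\sum_i a i) * \sum_i a i * b i ^+ 2.
Proof.
move=> a0; set s := \sum_i a i; set T := \sum_i a i * b i; set W := \sum_i _.
have s0 : 0 <= s by apply: sumr_ge0.
have [s_0|sn0] := eqVneq s 0.
  have T0 : T = 0.
    by rewrite /T big1// => i _; rewrite (psumr_eq0P _ s_0)// mul0r.
  by rewrite T0 expr0n s_0 mul0r.
have sp : 0 < s by rewrite lt_neqAle eq_sym sn0.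
have : 0 <= \sum_i a i * (b i * s - T) ^+ 2.
  by apply: sumr_ge0 => i _; rewrite mulr_ge0 ?sqr_ge0.
have -> : \sum_i a i * (b i * s - T) ^+ 2 = s * (s * W - T ^+ 2).
  transitivity (\sum_i (s ^+ 2 * (a i * b i ^+ 2)
                        - 2 * s * T * (a i * b i) + T ^+ 2 * a i)).
    by apply: eq_bigr => i _; ring.
  by rewrite big_split sumrB /= -!mulr_sumr -/s -/T -/W; ring.
by rewrite pmulr_rge0// subr_ge0.
Qed.

(** The [g i] are the gradients of the barycentric coordinates, obtained by
    inverting the matrix of the edges issued from the first vertex. *)
Lemma barycentric_gradients (p : 'I_n.+1 -> 'cV[R]_n) :
  affinely_independent p ->
  exists g : 'I_n.+1 -> 'cV[R]_n,
    [/\ \sum_i g i = 0, \sum_i dot (p i) (g i) = n%:R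
      & forall l i, \sum_j l j = 0 -> dot (\sum_j l j *: p j) (g i) = l i].
Proof.
move=> ip.
pose e j := p (lift ord0 j) - p ord0.
pose E : 'M[R]_n := \matrix_(j, a) e j a ord0.
have uE : E \in unitmx.
  rewrite -row_free_unit; apply: inj_row_free => w wE.
  have we : \sum_j w ord0 j *: e j = 0.
    apply/matrixP => a b; rewrite (ord1 b) summxE.
    transitivity ((w *m E) ord0 a); last by rewrite wE !mxE.
    by rewrite [RHS]mxE; apply: eq_bigr => j _; rewrite !mxE.
  pose l i := if unlift ord0 i is Some j then w ord0 j else - \sum_j w ord0 j.
  have l0 : l ord0 = - \sum_j w ord0 j by rewrite /l unlift_none.
  have lS j : l (lift ord0 j) = w ord0 j by rewrite /l liftK.
  have hl : forall i, l i = 0.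
    apply: ip; rewrite big_ord_recl; under eq_bigr do rewrite lS.
      by rewrite l0 addNr.
    rewrite l0 scaleNr scaler_suml addrC -sumrB -[RHS]we.
    by apply: eq_bigr => j _; rewrite /e scalerBr.
  by apply/matrixP => a b; rewrite ord1 [RHS]mxE -lS hl.
pose h j : 'cV[R]_n := col j (invmx E).
have eh i j : dot (e i) (h j) = (i == j)%:R.
  have : (E *m invmx E) i j = (1%:M : 'M[R]_n) i j by rewrite mulmxV.
  by rewrite !mxE => <-; apply: eq_bigr => a _; rewrite !mxE.
pose g i := if unlift ord0 i is Some j then h j else - \sum_j h j.
have g0 : g ord0 = - \sum_j h j by rewrite /g unlift_none.
have gS j : g (lift ord0 j) = h j by rewrite /g liftK.
exists g; split.
- by rewrite big_ord_recl; under eq_bigr do rewrite gS; rewrite g0 addNr.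
- rewrite big_ord_recl; under eq_bigr do rewrite gS.
  rewrite g0 dotNr dot_sumr addrC -sumrB.
  under eq_bigr do rewrite -dotNl -dotDl eh eqxx.
  by rewrite sumr_const card_ord.
move=> l i l1.
have lh j : dot (\sum_k l k *: p k) (h j) = l (lift ord0 j).
  have -> : \sum_k l k *: p k = \sum_k l (lift ord0 k) *: e k.
    move: l1; rewrite !big_ord_recl => /eqP; rewrite addr_eq0 => /eqP ->.
    rewrite scaleNr scaler_suml addrC -sumrB.
    by apply: eq_bigr => k _; rewrite /e scalerBr.
  rewrite dot_suml (bigD1 j)//= dotZl eh eqxx mulr1 big1 ?addr0// => k kj.
  by rewrite dotZl eh (negbTE kj) mulr0.
case: (unliftP ord0 i) => [j ->|->]; first by rewrite gS lh.
rewrite g0 dotNr dot_sumr; under eq_bigr do rewrite lh.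
by move: l1; rewrite big_ord_recl => /eqP; rewrite addr_eq0 => /eqP ->.
Qed.

(** The [i]-th barycentric coordinate varies by [rho * |g i|] from the centre of
    the ball to its boundary while staying nonnegative, so
    [rho * sum |g i| <= 1]. On the other hand [n = sum <p i - z, g i>] for every
    [z]. By the Cauchy-Schwarz inequality [n] is at most [sum |g i|] times the
    root mean square, with weights [|g i|], of the distances from the vertices
    to [z]; for [z] the weighted mean of the vertices, this is controlled by
    their mutual distances. *)
Lemma simplex_diameter (p : 'I_n.+1 -> 'cV[R]_n) c (rho D : R) :
  affinely_independent p -> 0 <= rho -> eball c rho `<=` finite_convex_hull p ->
  (forall i j, enorm (p i - p j) <= D) ->
  rho ^+ 2 * (2 * n%:R * (n%:R + 1)) <= D ^+ 2.
Proof.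
move=> ip rho0 cp hD.
have [g [sg tg cg]] := barycentric_gradients ip.
have n1 : 1 <= n%:R :> R by rewrite ler1n.
pose a i := enorm (g i).
have a0 i : 0 <= a i := enorm_ge0 _.
pose s := \sum_i a i.
have [l [l0 l1 cl]] := cp _ (eball_center c rho0).
have al i : rho * a i <= l i.
  have [ai0|ain] := eqVneq (a i) 0; first by rewrite ai0 mulr0.
  have ap : 0 < a i by rewrite lt_neqAle eq_sym ain a0.
  have [|k [k0 k1 ck]] := cp (c - rho *: ((a i)^-1 *: g i)).
    apply: eball_translate; rewrite enormN !enormZ !ger0_norm ?invr_ge0//.
    by rewrite mulVf// mulr1.
  have := cg (fun j => l j - k j) i.
  rewrite sumrB l1 k1 subrr => /(_ erefl).
  under eq_bigr do rewrite scalerBl.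
  rewrite sumrB -cl -ck opprB addrC subrK !dotE -sqr_enorm -/(a i).
  by rewrite expr2 mulKf// => ->; have := k0 i; lra.
have rs : rho * s <= 1 by rewrite /s mulr_sumr -l1; apply: ler_sum => i _.
have s0 : 0 <= s by apply: sumr_ge0.
have sp : 0 < s.
  rewrite lt_neqAle s0 andbT eq_sym; apply/eqP => s_0.
  have : \sum_i dot (p i) (g i) = 0.
    rewrite big1// => i _; have /enorm_eq0 -> : enorm (g i) = 0.
      exact: (psumr_eq0P _ s_0).
    by rewrite dot0r.
  by rewrite tg; lra.
pose z := s^-1 *: \sum_i a i *: p i.
pose q i := p i - z.
have aq : \sum_i a i *: q i = 0.
  under eq_bigr do rewrite /q scalerBr.
  by rewrite sumrB -scaler_suml -/s /z scalerA mulfV ?gt_eqF// scale1r subrr.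
pose W := \sum_i a i * enorm (q i) ^+ 2.
have nW : n%:R ^+ 2 <= s * W.
  apply: le_trans (sum_cauchy_schwarz _ a0).
  rewrite ler_sqr ?nnegrE//; last first.
    by apply: sumr_ge0 => i _; rewrite mulr_ge0 ?enorm_ge0.
  have -> : n%:R = \sum_i dot (q i) (g i).
    under eq_bigr do rewrite /q dotDl.
    by rewrite big_split /= tg -dot_sumr sg dot0r addr0.
  apply: ler_sum => i _; rewrite mulrC; exact: cauchy_schwarz.
have D0 : 0 <= D by apply: le_trans (enorm_ge0 _) (hD ord0 ord0).
have qq i j : q i - q j = p i - p j by rewrite /q opprB addrA subrK.
clearbody q.
(* The variance of the weighted points [q i] in terms of their mutual distances;
   the diagonal pairs do not contribute. *)
have WD : 2 * s * W <= D ^+ 2 * (s ^+ 2 - \sum_i a i ^+ 2).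
  have -> : 2 * s * W = \sum_i \sum_j a i * a j * dot (q i - q j) (q i - q j).
    have inner i : \sum_j a i * a j * dot (q i - q j) (q i - q j)
        = s * (a i * enorm (q i) ^+ 2) + a i * W.
      transitivity (s * (a i * enorm (q i) ^+ 2) + a i * W
                    - 2 * a i * dot (q i) (\sum_j a j *: q j)).
        rewrite dot_sumr /s /W mulr_suml !mulr_sumr -big_split -sumrB.
        apply: eq_bigr => j _ /=.
        by rewrite !dotE (dotC (q j)) -!sqr_enorm; ring.
      by rewrite aq dot0r mulr0 subr0.
    under eq_bigr do rewrite inner.
    by rewrite big_split /= -mulr_sumr -mulr_suml -/W -/s; ring.
  have -> : D ^+ 2 * (s ^+ 2 - \sum_i a i ^+ 2)
      = \sum_i \sum_j (a i * a j * D ^+ 2 * (i != j)%:R).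
    have inner i : \sum_j (a i * a j * D ^+ 2 * (i != j)%:R)
        = D ^+ 2 * (a i * s - a i ^+ 2).
      rewrite (bigD1 i)//= eqxx mulr0 add0r /s [in RHS](bigD1 i)//=.
      rewrite [X in D ^+ 2 * (X - _)]mulrDr -expr2 addrAC subrr add0r.
      rewrite !mulr_sumr.
      by apply: eq_bigr => j ji; rewrite eq_sym ji mulr1; ring.
    under [RHS]eq_bigr do rewrite inner.
    by rewrite -mulr_sumr sumrB -mulr_suml expr2.
  apply: ler_sum => i _; apply: ler_sum => j _.
  have [->|ij] := eqVneq i j; first by rewrite subrr dot0l !mulr0.
  rewrite mulr1 ler_wpM2l ?mulr_ge0// -enorm_le//.
  by rewrite qq.
have sa : s ^+ 2 <= (n%:R + 1) * \sum_i a i ^+ 2.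
  have := @sum_cauchy_schwarz _ (fun _ : 'I_n.+1 => 1) a (fun=> ler01).
  rewrite sumr_const card_ord natr1.
  by under eq_bigr do rewrite mul1r; under [in leRHS]eq_bigr do rewrite mul1r.
have : n%:R ^+ 2 * (2 * (n%:R + 1)) <= D ^+ 2 * (s ^+ 2 * n%:R).
  have D2 := sqr_ge0 D.
  have : (n%:R + 1) * (D ^+ 2 * (s ^+ 2 - \sum_i a i ^+ 2))
      <= D ^+ 2 * (s ^+ 2 * n%:R).
    by rewrite mulrCA ler_wpM2l//; lra.
  have : 0 <= (n%:R + 1) * (D ^+ 2 * (s ^+ 2 - \sum_i a i ^+ 2) - 2 * s * W).
    by rewrite mulr_ge0//; lra.
  have : 0 <= (n%:R + 1) * (s * W - n%:R ^+ 2) by rewrite mulr_ge0//; lra.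
  by lra.
move=> h0; have h : 2 * n%:R * (n%:R + 1) <= D ^+ 2 * s ^+ 2.
  rewrite -(@ler_pM2l _ n%:R); first by lra.
  by lra.
apply: (@le_trans _ _ (rho ^+ 2 * (D ^+ 2 * s ^+ 2))).
  by rewrite ler_wpM2l ?sqr_ge0.
rewrite mulrCA -exprMn ler_piMr ?sqr_ge0//.
by rewrite expr_le1// mulr_ge0.
Qed.

Lemma simplex_image (A : 'M[R]_n) (p : 'I_n.+1 -> 'cV[R]_n) :
  A \in unitmx -> affinely_independent p ->
  affinely_independent (fun i => A *m p i) /\
  linear_image A (finite_convex_hull p)
    = finite_convex_hull (fun i => A *m p i).
Proof.
move=> uA ip; have mulA l : \sum_i l i *: (A *m p i) = A *m \sum_i l i *: p i.
  by rewrite mulmx_sumr; apply: eq_bigr => i _; rewrite scalemxAr.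
split.
  move=> l l0; rewrite mulA => lA; apply: ip => //.
  by rewrite -(mulKmx uA (\sum_i _)) lA mulmx0.
apply/seteqP; split.
  by move=> _ [x [l [l0 l1 ->]] <-]; exists l; split=> //; rewrite mulA.
move=> x [l [l0 l1 ->]]; exists (\sum_i l i *: p i); last by rewrite mulA.
by exists l.
Qed.

Lemma vertex_hull (p : 'I_n.+1 -> 'cV[R]_n) i : finite_convex_hull p (p i).
Proof.
exists (fun j => (j == i)%:R); split=> //.
  by rewrite (bigD1 i)//= eqxx big1 ?addr0// => j /negbTE ->.
rewrite (bigD1 i)//= eqxx scale1r big1 ?addr0// => j /negbTE ->.
by rewrite scale0r.
Qed.

Lemma sharp_constantE : Num.sqrt ((n * n.+1)%:R / 2)
  = Num.sqrt (2 * n%:R * (n%:R + 1)) / 2 :> R.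
Proof.
have -> : (n * n.+1)%:R / 2 = (2^-1) ^+ 2 * (2 * n%:R * (n%:R + 1)) :> R.
  by rewrite natrM -natr1; field.
by rewrite [LHS]sqrtrM ?sqr_ge0// sqrtr_sqr ger0_norm ?invr_ge0// mulrC.
Qed.

Lemma simplex_ratio K (A : 'M[R]_n) : convex_body K -> is_simplex K ->
  A \in unitmx ->
  Num.sqrt ((n * n.+1)%:R / 2)
    <= diameter (linear_image A K) / (2 * inradius (linear_image A K)).
Proof.
move=> [cK vK iK] [p [ip Kp]] uA; have bK := compact_ebounded cK.
have [c [rho rho0 cK0]] := interior_eball iK.
have r0 := inradius_gt0 n_gt0 bK rho0 cK0 uA.
have [ipA hA] := simplex_image uA ip; rewrite -Kp in hA.
have bA := ebounded_image A bK.
have A0 : linear_image A K !=set0.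
  by exists (A *m c), c => //; apply: cK0; apply: eball_center; exact: ltW.
set D := diameter _; set r := inradius _ in r0 *.
have D0 : 0 <= D := diameter_ge0 bA A0.
set N : R := 2 * n%:R * (n%:R + 1).
have N0 : 0 < N by rewrite /N !mulr_gt0 ?ltr0n// natr1 ltr0n.
have rD : r <= D / Num.sqrt N.
  apply: inradius_le => // d s s0 dA.
  rewrite ler_pdivlMr ?sqrtr_gt0// -ler_sqr ?nnegrE ?mulr_ge0 ?sqrtr_ge0//.
  rewrite exprMn sqr_sqrtr ?(ltW N0)//.
  apply: (simplex_diameter ipA s0 (c := d)); first by rewrite -hA.
  by move=> i j; apply: le_diameter => //; rewrite hA; exact: vertex_hull.
rewrite sharp_constantE -/N ler_pdivlMr ?mulr_gt0//.
rewrite ler_pdivlMr ?sqrtr_gt0// in rD.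
lra.
Qed.

End SimplexBound.

Lemma simplex_affine_preimage (R : realType) (n : nat) (K : set 'cV[R]_n)
    (G : 'M[R]_n) c : G \in unitmx ->
  is_simplex [set y | K (c + G *m y)] -> is_simplex K.
Proof.
move=> uG [p [ip Kp]].
have comb (l : 'I_n.+1 -> R) : \sum_i l i *: (c + G *m p i)
    = (\sum_i l i) *: c + G *m \sum_i l i *: p i.
  rewrite scaler_suml mulmx_sumr -big_split; apply: eq_bigr => i _ /=.
  by rewrite scalerDr scalemxAr.
exists (fun i => c + G *m p i); split.
  move=> l l0; rewrite comb l0 scale0r add0r => lG; apply: ip => //.
  by rewrite -(mulKmx uG (\sum_i _)) lG mulmx0.
have KE y : K (c + G *m y) <-> finite_convex_hull p y by rewrite -Kp.
apply/seteqP; split=> [x Kx|x [l [l0 l1 ->]]].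
  have [|l [l0 l1 xl]] := (KE (invmx G *m (x - c))).1.
    by rewrite mulKVmx// addrC subrK.
  exists l; split=> //; rewrite comb l1 scale1r -xl mulKVmx//.
  by rewrite addrC subrK.
by rewrite comb l1 scale1r; apply/KE; exists l.
Qed.

Theorem theorem5p5 (R : realType) (n : nat) (n_gt0 : (0 < n)%N)
    (K : set 'cV[R]_n) (hK : convex_body K) :
  exists m : R,
    [/\ is_minimum (diameter_inradius_ratios K) m,
        m <= Num.sqrt ((n * n.+1)%:R / 2)
      & m = Num.sqrt ((n * n.+1)%:R / 2) <-> is_simplex K].
Proof.
have [m [mK mmin]] := ratio_min n_gt0 hK.
have [G [c [uG jK]]] := john_ellipsoid hK.
have [cK _ _] := hK; have bK := compact_ebounded cK.
have [cK' _ BK' _] := jK; have bK' := compact_ebounded cK'.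
set K' := [set y | _] in jK cK' BK' bK'.
have mle A : A \in unitmx ->
    m <= diameter (linear_image A K') / (2 * inradius (linear_image A K')).
  move=> uA; apply: le_trans (ratio_affine n_gt0 bK bK' ltr01 BK' uG uA).
  by apply: mmin; exists (A *m invmx G); rewrite //= unitmx_mul uA unitmx_inv.
have mub : m <= Num.sqrt ((n * n.+1)%:R / 2).
  apply: le_trans (mle _ (unitmx1 R n)) _.
  have -> : linear_image 1%:M K' = K'.
    apply/seteqP; split=> [_ [x Kx <-]|x Kx]; first by rewrite mul1mx.
    by exists x; rewrite ?mul1mx.
  apply: le_trans (ratio_le n_gt0 bK' ltr01 BK'
    (fun x y => john_diam n_gt0 jK)) _.
  by rewrite mulr1 sharp_constantE.
exists m; split=> //; split=> [mE|sK].
  apply: (simplex_affine_preimage uG (c := c)); apply: contrapT => nsK.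
  have [A uA] := john_not_simplex n_gt0 jK nsK.
  by rewrite ltNge -mE mle.
apply/eqP; rewrite eq_le mub /=; case: mK => A uA <-.
exact: simplex_ratio.
Qed.
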